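(* Let $\epsilon>0$, $\kappa>0$ and let $J(P,\lambda,q)$, the compact feasible set $\mathcal{S}$, the bounds $\underline P,\bar P,\underline\lambda,\bar\lambda,\underline q,\bar q$, and the Frank–Wolfe iterates $(P^{(k)},\lambda^{(k)},q^{(k)})$ with step sizes $\rho^{(k)}=2/(k+2)$ be as defined in the context. Let $(P^{\star},\lambda^{\star},q^{\star})$ be the optimal solution of the design problem and $J^{(k)}=J(P^{(k)},\lambda^{(k)},q^{(k)})$. Then, for any integer $k>0$, $$J^{(k)}-J(P^{\star},\lambda^{\star},q^{\star})\le\frac{2\bar{\mathcal{C}}_J(1+\gamma_0)}{k+2},$$ where $\gamma_0$ is the solution accuracy of the direction-finding subproblem and $$\bar{\mathcal{C}}_J=\left(\lVert\bar P-\underline P\rVert_F^2+|\bar\lambda-\underline\lambda|^2+\lVert\bar q-\underline q\rVert^2\right)\cdot\left(\frac{\bar\lambda\epsilon+2\epsilon\lVert\bar P\rVert_F+2\lVert\Omega\rVert_2^2}{2\kappa^2}+\frac{n_\xi\epsilon}{2\underline\lambda}\right).$$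
   Context: Design problem. Minimize $$J(P,\lambda,q)=\lambda\theta-\frac{\lambda\epsilon}{2}\log\det\Sigma+\frac{\lambda\epsilon n_\xi}{2}\log\left(\frac{\lambda\epsilon}{2}\right)-\frac{\lambda\epsilon}{2}\log\det(\lambda\Omega-P)+\frac1N\sum_{i=1}^Nq_i$$ over $\Phi=[\Phi_x\ \Phi_y]$, symmetric $P\in\mathbb{S}^{n_\xi}$, $\lambda\ge0$, $q\in\mathbb{R}^N$, subject to the constraints $$(\ast)\quad \begin{bmatrix}\lambda\Omega-P&\lambda\hat\xi_i\\ \lambda\hat\xi_i^\top&\lambda\hat\xi_i^\top\hat\xi_i+q_i\end{bmatrix}\succeq0\ (i=1,\dots,N),\ \begin{bmatrix}P&Q^\top\Phi^\top\\ \Phi Q&I\end{bmatrix}\succeq0,\ \lambda\Omega-P\succeq\kappa I,\ \Phi R=I,\ \Phi_x,\Phi_y\text{ block lower-triangular},$$ where $\Omega=I+\frac{\epsilon}{2}\Sigma^{-1}$, $\Sigma\succ0$, $\hat\xi_1,\dots,\hat\xi_N\in\mathbb{R}^{n_\xi}$ are given samples, $\theta$ is a radius, and $\kappa>0$ is sufficiently small. The problem is assumed strictly feasible: $\theta>\theta_0$ with $\theta_0=\frac{\epsilon}{2}\log\det\Sigma-\frac{\epsilon n_\xi}{2}\log(\frac{\epsilon}{2})+\frac{\epsilon}{2}\log\det\Omega+\frac1N\sum_i\hat\xi_i^\top(I-\Omega^{-1})\hat\xi_i$. Matrices $R,Q$: given $A_t\in\mathbb{R}^{n_x\times n_x}$,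 $B_t\in\mathbb{R}^{n_x\times n_w}$, $C_t\in\mathbb{R}^{n_y\times n_x}$, $D_t\in\mathbb{R}^{n_y\times n_w}$ of a (uniformly completely observable) linear time-varying system $x(t+1)=A_tx(t)+B_tw(t)$, $y(t)=C_tx(t)+D_tw(t)$, initial time $t_0$, horizon $T\ge n_x$, $n_\xi=n_x+Tn_w$; $Z$ is the $(T+1)n_x\times(T+1)n_x$ block-downshift matrix (blocks $I_{n_x}$ on the first block subdiagonal, zero elsewhere); $\bar A=\mathrm{diag}\{A_{t_0},\dots,A_{t_0+T-1},0_{n_x\times n_x}\}$, $\bar B=\mathrm{diag}\{I_{n_x},B_{t_0},\dots,B_{t_0+T-1}\}$, $\bar C=\mathrm{diag}\{0_{n_y\times n_x},C_{t_0},\dots,C_{t_0+T-1}\}$, $\bar D=\mathrm{diag}\{0_{n_y\times n_x},D_{t_0},\dots,D_{t_0+T-1}\}$; $R=\begin{bmatrix}I-Z\bar A\\ \bar CZ\end{bmatrix}$, $Q=\begin{bmatrix}\bar B\\-\bar D\end{bmatrix}$; $\Phi_x\in\mathbb{R}^{(T+1)n_x\times(T+1)n_x}$, $\Phi_y\in\mathbb{R}^{(T+1)n_x\times(T+1)n_y}$, with block lower-triangularity with respect to the $(T+1)\times(T+1)$ block partition. Bounds. Given an initial feasible solution $(\Phi^{(0)},P^{(0)},\lambda^{(0)},q^{(0)})$, set $\bar\lambda=\hat J(P^{(0)},\lambda^{(0)})/(\theta-\theta_0)$, where $\hat J(P,\lambda)$ is $J(P,\lambda,q)$ with $q_i=\lambda^2\hat\xi_i^\top(\lambda\Omega-P)^{-1}\hat\xi_i-\lambda\hat\xi_i^\top\hat\xi_i$;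 $\underline P=Q^\top(R^\dagger)^\top R^\dagger Q$ ($\dagger$: Moore–Penrose inverse); $\bar P=\bar\lambda\Omega+\kappa I$; $\underline\lambda=\bar\sigma(\Omega^{-1}\underline P+\kappa\Omega^{-1})$ ($\bar\sigma$: maximum eigenvalue); $\underline q_i=\underline\lambda^2\hat\xi_i^\top(\bar\lambda\Omega-\underline P)^{-1}\hat\xi_i-\bar\lambda\hat\xi_i^\top\hat\xi_i$; $\bar q_i=\bar\lambda^2\hat\xi_i^\top\hat\xi_i/\kappa-\underline\lambda\hat\xi_i^\top\hat\xi_i$. Define $$\mathcal{S}=\{(\Phi,P,\lambda,q):\ \underline P\preceq P\preceq\bar P,\ \underline\lambda\le\lambda\le\bar\lambda,\ \underline q\le q\le\bar q,\ (\ast)\text{ holds}\}.$$ The optimal solution of the design problem lies in $\mathcal{S}$. Frank–Wolfe iteration. The starting point lies in $\mathcal{S}$. For $k=0,1,2,\dots$, solve the direction-finding subproblem $$\min_{(\Phi,\tilde P,\tilde\lambda,\tilde q)\in\mathcal{S}}\ \langle\tilde P,\nabla_PJ^{(k)}\rangle+\tilde\lambda\,\nabla_\lambda J^{(k)}+\tilde q^\top\nabla_qJ^{(k)},$$ where $\nabla J^{(k)}$ is the gradient of $J$ at $(P^{(k)},\lambda^{(k)},q^{(k)})$, obtaining $(\tilde P^{\star},\tilde\lambda^{\star},\tilde q^{\star})$, and set $P^{(k+1)}=(1-\rho^{(k)})P^{(k)}+\rho^{(k)}\tilde P^{\star}$, and likewise for $\lambda^{(k+1)}$ and $q^{(k+1)}$,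 with $\rho^{(k)}=2/(k+2)$. Solution accuracy $\gamma_0\ge0$ (the standard convention for inexact Frank–Wolfe): the subproblem at iteration $k$ is solved up to an additive error of at most $\frac12\gamma_0\rho^{(k)}\mathcal{C}_J$, where $\mathcal{C}_J$ is the curvature constant of $J$ over the projection of $\mathcal{S}$ onto the variables $v=(P,\lambda,q)$, i.e. $\mathcal{C}_J=\sup\frac{2}{\rho^2}\left(J(v')-J(v)-\langle v'-v,\nabla J(v)\rangle\right)$ over $v,s$ in that projection, $\rho\in(0,1]$, $v'=v+\rho(s-v)$; $\gamma_0=0$ is exact solution. $\lVert\cdot\rVert_F$, $\lVert\cdot\rVert_2$, $\lVert\cdot\rVert$ are the Frobenius, spectral and Euclidean norms. *)

(* Defs.v *)
From HB Require Import structures.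
From mathcomp Require Import all_boot all_order all_algebra.
From mathcomp Require Import all_classical all_reals all_analysis.

Set Implicit Arguments.
Unset Strict Implicit.
Unset Printing Implicit Defensive.

Import Order.TTheory GRing.Theory Num.Theory.
Import numFieldNormedType.Exports.

Local Open Scope classical_set_scope.
Local Open Scope ring_scope.

Section Matrices.
Context {R : realType}.

Definition quad n (A : 'M[R]_n) (x : 'cV[R]_n) : R := (x^T *m A *m x) 0 0.

Definition psd n (A : 'M[R]_n) : Prop :=
  A^T = A /\ forall x : 'cV[R]_n, 0 <= quad A x.

Definition posdef n (A : 'M[R]_n) : Prop :=
  A^T = A /\ forall x : 'cV[R]_n, x != 0 -> 0 < quad A x.

(* Loewner order *)
Definition loewner_le n (A B : 'M[R]_n) : Prop := psd (B - A).

Definition frob_norm m n (A : 'M[R]_(m, n)) : R :=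
  Num.sqrt (\sum_i \sum_j A i j ^+ 2).

Definition eucl_norm n (x : 'cV[R]_n) : R := Num.sqrt (\sum_i x i 0 ^+ 2).

(* Largest real eigenvalue; only meant for matrices with real spectrum and
   n > 0, for which the supremum is a maximum. *)
Definition max_eig n (A : 'M[R]_n) : R := sup [set a : R | eigenvalue A a].

(* Largest singular value. *)
Definition spec_norm m n (A : 'M[R]_(m, n)) : R :=
  Num.sqrt (max_eig (A^T *m A)).

Definition is_mp_inverse m n (A : 'M[R]_(m, n)) (X : 'M[R]_(n, m)) : Prop :=
  [/\ A *m X *m A = A, X *m A *m X = X,
      (A *m X)^T = A *m X & (X *m A)^T = X *m A].

Definition mp_inverse m n (A : 'M[R]_(m, n)) : 'M[R]_(n, m) :=
  xget 0 [set X | is_mp_inverse A X].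

End Matrices.

(* Total size of b + 1 stacked blocks of size n. *)
Notation stacked T n := (\sum_(i < T.+1) n)%N.

Definition blocks_lower (R : realType) T m n
    (A : 'M[R]_(stacked T m, stacked T n)) : Prop :=
  forall i j : 'I_T.+1, (i < j)%N ->
    (submxblock A i j : 'M[R]_(m, n)) = 0.

(* Column-block sizes of the uncertainty xi = (x(t0), w(t0), ..., w(t0+T-1)). *)
Definition xi_block (nx nw j : nat) : nat := if j is 0 then nx else nw.

Definition xi_dim (nx nw T : nat) : nat := (\sum_(j < T.+1) xi_block nx nw j)%N.

Lemma xi_dimE nx nw T : xi_dim nx nw T = (nx + T * nw)%N.
Proof.
by rewrite /xi_dim big_ord_recl /= big_const_ord iter_addn_0 mulnC.
Qed.

Record design_data (R : realType) (nx nw ny T N : nat) := DesignData {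
  sysA : int -> 'M[R]_nx;
  sysB : int -> 'M[R]_(nx, nw);
  sysC : int -> 'M[R]_(ny, nx);
  sysD : int -> 'M[R]_(ny, nw);
  t0 : int;
  Sigma : 'M[R]_(xi_dim nx nw T);
  xihat : 'I_N -> 'cV[R]_(xi_dim nx nw T);
  eps : R;
  theta : R;
  kappa : R }.

Section Design.
Context {R : realType} {nx nw ny T N : nat}.
Variable d : design_data R nx nw ny T N.

Local Notation n := (xi_dim nx nw T).
Local Notation NX := (stacked T nx).
Local Notation NY := (stacked T ny).
Local Notation A := (sysA d).
Local Notation B := (sysB d).
Local Notation C := (sysC d).
Local Notation D := (sysD d).
Local Notation t0 := (t0 d).
Local Notation Sigma := (Sigma d).
Local Notation xi := (xihat d).
Local Notation eps := (eps d).
Local Notation theta := (theta d).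
Local Notation kappa := (kappa d).

(* State transition matrix from time t to time t + k. *)
Fixpoint transition (t : int) (k : nat) : 'M[R]_nx :=
  if k is k'.+1 then A (t + k'%:Z) *m transition t k' else 1%:M.

Definition obs_gramian (t : int) (h : nat) : 'M[R]_nx :=
  \sum_(k < h) (C (t + k%:Z) *m transition t k)^T
               *m (C (t + k%:Z) *m transition t k).

Definition uniformly_completely_observable : Prop :=
  exists (h : nat) (a b : R), [/\ 0 < a, 0 < b &
    forall t : int, t0 <= t ->
      loewner_le a%:M (obs_gramian t h) /\ loewner_le (obs_gramian t h) b%:M].

Definition Zmx : 'M[R]_NX :=
  \mxblock_(i < T.+1, j < T.+1) (if i == j.+1 :> nat then 1%:M else 0 : 'M[R]_nx).

Definition Abar : 'M[R]_NX :=
  \mxdiag_(i < T.+1) (if (i < T)%N then A (t0 + (i : nat)%:Z) else 0 : 'M[R]_nx).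

(* The matrices below are block diagonal with rectangular diagonal blocks. *)

Definition Bblock (j : nat) : 'M[R]_(nx, xi_block nx nw j) :=
  if j is k.+1 then B (t0 + k%:Z) else 1%:M.

Definition Cblock (j : nat) : 'M[R]_(ny, nx) :=
  if j is k.+1 then C (t0 + k%:Z) else 0.

Definition Dblock (j : nat) : 'M[R]_(ny, xi_block nx nw j) :=
  if j is k.+1 then D (t0 + k%:Z) else 0.

Definition Bbar : 'M[R]_(NX, n) :=
  \mxblock_(i < T.+1, j < T.+1) (if i == j then Bblock j else 0 : 'M[R]_(nx, xi_block nx nw j)).

Definition Cbar : 'M[R]_(NY, NX) :=
  \mxblock_(i < T.+1, j < T.+1) (if i == j then Cblock j else 0 : 'M[R]_(ny, nx)).

Definition Dbar : 'M[R]_(NY, n) :=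
  \mxblock_(i < T.+1, j < T.+1) (if i == j then Dblock j else 0 : 'M[R]_(ny, xi_block nx nw j)).

Definition Rmx : 'M[R]_(NX + NY, NX) :=
  col_mx (1%:M - Zmx *m Abar) (Cbar *m Zmx).

Definition Qmx : 'M[R]_(NX + NY, n) := col_mx Bbar (- Dbar).

Definition Omega : 'M[R]_n := 1%:M + (eps / 2) *: invmx Sigma.

Definition J (P : 'M[R]_n) (lam : R) (q : 'cV[R]_N) : R :=
  lam * theta - lam * eps / 2 * ln (\det Sigma)
  + lam * eps * n%:R / 2 * ln (lam * eps / 2)
  - lam * eps / 2 * ln (\det (lam *: Omega - P))
  + N%:R^-1 * \sum_i q i 0.

Definition theta0 : R :=
  eps / 2 * ln (\det Sigma) - eps * n%:R / 2 * ln (eps / 2)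
  + eps / 2 * ln (\det Omega)
  + N%:R^-1 * \sum_i quad (1%:M - invmx Omega) (xi i).

(* v = (P, lambda, q) *)
Definition var : Type := ('M[R]_n * R^o * 'cV[R]_N)%type.

Definition vP (v : var) : 'M[R]_n := v.1.1.
Definition vlam (v : var) : R := v.1.2.
Definition vq (v : var) : 'cV[R]_N := v.2.

Definition Jv (v : var) : R := J (vP v) (vlam v) (vq v).

Definition var_dot (u v : var) : R :=
  \tr ((vP u)^T *m vP v) + vlam u * vlam v + \sum_i vq u i 0 * vq v i 0.

(* J is extended to all square matrices P, so that its partial derivatives in
   the entries of P make sense; at a symmetric P the matrix they form is
   symmetric, hence is the gradient for the trace inner product on symmetric
   matrices. *)
Definition gradP (v : var) : 'M[R]_n :=
  \matrix_(i, j) 'D_(delta_mx i j) (fun P => J P (vlam v) (vq v)) (vP v).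

Definition gradlam (v : var) : R :=
  derive1 (fun l : R => J (vP v) l (vq v)) (vlam v).

Definition gradq (v : var) : 'cV[R]_N :=
  \col_i 'D_(delta_mx i 0) (J (vP v) (vlam v)) (vq v).

Definition gradJ (v : var) : var := (gradP v, gradlam v, gradq v).

(* Phi = [Phi_x Phi_y], with Phi_x = lsubmx Phi and Phi_y = rsubmx Phi. *)
Definition design_constraints (Phi : 'M[R]_(NX, NX + NY)) (v : var) : Prop :=
  let P := vP v in let lam := vlam v in let q := vq v in
  [/\ P^T = P,
      forall i, psd (block_mx (lam *: Omega - P) (lam *: xi i)
                      (lam *: (xi i)^T)
                      (lam *: ((xi i)^T *m xi i) + (q i 0)%:M)),
      psd (block_mx P (Qmx^T *m Phi^T) (Phi *m Qmx) 1%:M),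
      loewner_le kappa%:M (lam *: Omega - P) &
      [/\ Phi *m Rmx = 1%:M, blocks_lower (lsubmx Phi) &
          blocks_lower (rsubmx Phi)]].

Definition design_feasible (Phi : 'M[R]_(NX, NX + NY)) (v : var) : Prop :=
  0 <= vlam v /\ design_constraints Phi v.

Definition design_optimal (Phi : 'M[R]_(NX, NX + NY)) (v : var) : Prop :=
  design_feasible Phi v /\
  forall Phi' v', design_feasible Phi' v' -> Jv v <= Jv v'.

Definition Jhat (P : 'M[R]_n) (lam : R) : R :=
  J P lam (\col_i (lam ^+ 2 * quad (invmx (lam *: Omega - P)) (xi i)
                   - lam * quad 1%:M (xi i))).

(* v0 is the initial feasible solution from which the bounds are computed. *)
Section Bounds.
Variable v0 : var.

Definition lam_up : R := Jhat (vP v0) (vlam v0) / (theta - theta0).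

Definition P_low : 'M[R]_n :=
  Qmx^T *m (mp_inverse Rmx)^T *m mp_inverse Rmx *m Qmx.

Definition P_up : 'M[R]_n := lam_up *: Omega + kappa%:M.

Definition lam_low : R :=
  max_eig (invmx Omega *m P_low + kappa *: invmx Omega).

Definition q_low : 'cV[R]_N :=
  \col_i (lam_low ^+ 2 * quad (invmx (lam_up *: Omega - P_low)) (xi i)
          - lam_up * quad 1%:M (xi i)).

Definition q_up : 'cV[R]_N :=
  \col_i (lam_up ^+ 2 * quad 1%:M (xi i) / kappa
          - lam_low * quad 1%:M (xi i)).

Definition Sset (Phi : 'M[R]_(NX, NX + NY)) (v : var) : Prop :=
  [/\ loewner_le P_low (vP v), loewner_le (vP v) P_up,
      lam_low <= vlam v <= lam_up,
      forall i, q_low i 0 <= vq v i 0 <= q_up i 0 &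
      design_constraints Phi v].

Definition Sset_proj : set var := [set v | exists Phi, Sset Phi v].

(* The curvature constant of J over Sset_proj. *)
Definition curvature : R :=
  sup [set c : R | exists v s : var, exists rho : R,
         [/\ Sset_proj v, Sset_proj s, 0 < rho <= 1 &
             let v' : var := v + rho *: (s - v) in
             c = 2 / rho ^+ 2 * (Jv v' - Jv v - var_dot (v' - v) (gradJ v))]].

Definition curvature_bound : R :=
  (frob_norm (P_up - P_low) ^+ 2 + `|lam_up - lam_low| ^+ 2
   + eucl_norm (q_up - q_low) ^+ 2)
  * ((lam_up * eps + 2 * eps * frob_norm P_up + 2 * spec_norm Omega ^+ 2)
       / (2 * kappa ^+ 2)
     + n%:R * eps / (2 * lam_low)).

Definition step_size (k : nat) : R := 2 / (k%:R + 2).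

(* (Phi, s) solves the direction-finding subproblem of iteration k at v, up to
   an additive error gamma0 / 2 * step_size k * curvature. *)
Definition fw_direction (gamma0 : R) (k : nat) (v : var)
    (Phi : 'M[R]_(NX, NX + NY)) (s : var) : Prop :=
  Sset Phi s /\
  forall Phi' s', Sset Phi' s' ->
    var_dot s (gradJ v) <=
      var_dot s' (gradJ v) + 1 / 2 * gamma0 * step_size k * curvature.

Definition fw_next (k : nat) (v s : var) : var :=
  (1 - step_size k) *: v + step_size k *: s.

End Bounds.

End Design.

Arguments var : clear implicits.

(* Main.v *)
Require Import Defs.
From HB Require Import structures.
From mathcomp Require Import all_boot all_order all_algebra.
From mathcomp Require Import all_classical all_reals all_analysis.
From mathcomp Require Import ring lra.

Set Implicit Arguments.
Unset Strict Implicit.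
Unset Printing Implicit Defensive.

Import Order.TTheory GRing.Theory Num.Theory.
Import numFieldNormedType.Exports.

Local Open Scope ring_scope.

(** Write [M = lambda Omega - P], so that [M >= kappa I] on the feasible set.
    Up to linear terms, [J] is [lambda eps / 2] times
    [n ln lambda - ln (det M)], that is, the perspective of [- log det].
    Given two feasible points with slack matrices [M] and [M'], let [b_i] be the
    eigenvalues of [M^-1 (M' - M)], obtained by diagonalizing [M] and [M' - M]
    simultaneously by congruence ([pencil_diag], [pencil_spectrum]). With
    [a = lambda' / lambda], the Bregman divergence of [J] is
      [eps lambda / 2 * sum_i (a ln a - a ln (1 + b_i) - a + 1 + b_i)],
    a sum of scalar relative entropies ([bregman_J]). Each term is nonnegative,
    so [J] lies above its tangents ([J_ge_tangent]).

    For the upper bound ([J_le_tangent]), the second derivative of [J] along the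
    segment is
      [eps / 2 * sum_i (h - lambda_t beta_i)^2 / lambda_t],
    where [h] is the increment of [lambda], [D] that of the slack matrix, and
    the [beta_i] are the eigenvalues of [M_t^-1 D]. Since [M_t >= kappa I],
    [sum_i beta_i^2 = tr ((M_t^-1 D)^2)] is at most the squared Frobenius norm
    of [D] over [kappa^2] ([mxtrace_invmx_sq_le]). Feasible slack matrices lie
    between 0 and [P_up - P_low] in the Loewner order, so the difference of two
    of them has at most the Frobenius norm of [P_up - P_low]
    ([slackB_frob_norm]). The mixed terms in [h] and [beta_i]
    are absorbed by the summand [2 eps] times the norm of [P_up], which is at
    least [kappa sqrt n] ([sum_sqr_pencil_le]). Finally
    [lambda_t >= lam_low > 0], because [lam_low] is a maximal Rayleigh quotient
    of positive definite matrices ([max_eig_pencil_gt0]).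

    Thus the curvature constant is at most [curvature_bound], the feasible set
    is convex, and the classical recursion
      [gap (k+1) <= (1 - rho) gap k + rho^2 / 2 * C (1 + gamma0)]
    with [rho = 2 / (k + 2)] gives the rate ([fw_step_gap]). *)

(** * Quadratic forms and simultaneous diagonalization *)

Section Quadratic.
Context {R : realType}.

Lemma quadE n (A : 'M[R]_n) (x : 'cV[R]_n) :
  quad A x = \sum_j (\sum_i x i 0 * A i j) * x j 0.
Proof.
rewrite /quad !mxE; apply: eq_bigr => j _; rewrite !mxE; congr (_ * _).
by apply: eq_bigr => i _; rewrite !mxE.
Qed.

Lemma quadDl n (A B : 'M[R]_n) x : quad (A + B) x = quad A x + quad B x.
Proof. by rewrite /quad mulmxDr mulmxDl mxE. Qed.

Lemma quadNl n (A : 'M[R]_n) x : quad (- A) x = - quad A x.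
Proof. by rewrite /quad mulmxN mulNmx mxE. Qed.

Lemma quadZl n (A : 'M[R]_n) c x : quad (c *: A) x = c * quad A x.
Proof. by rewrite /quad -scalemxAr -scalemxAl mxE. Qed.

Lemma quadZr n (A : 'M[R]_n) c x : quad A (c *: x) = c ^+ 2 * quad A x.
Proof.
by rewrite /quad [(c *: x)^T]linearZ /= -scalemxAr -!scalemxAl !mxE mulrA expr2.
Qed.

Lemma quad0r n (A : 'M[R]_n) : quad A 0 = 0.
Proof. by rewrite /quad mulmx0 mxE. Qed.

Lemma quad_mulmx m n (A : 'M[R]_n) (B : 'M[R]_(n, m)) x :
  quad A (B *m x) = quad (B^T *m A *m B) x.
Proof. by rewrite /quad trmx_mul !mulmxA. Qed.

Lemma quad1E n (x : 'cV[R]_n) : quad 1%:M x = \sum_i x i 0 ^+ 2.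
Proof.
by rewrite /quad mulmx1 !mxE; apply: eq_bigr => i _; rewrite !mxE expr2.
Qed.

Lemma quad_scalar n c (x : 'cV[R]_n) : quad c%:M x = c * quad 1%:M x.
Proof. by rewrite -[c%:M]scalemx1 quadZl. Qed.

Lemma quad1_ge0 n (x : 'cV[R]_n) : 0 <= quad 1%:M x.
Proof. by rewrite quad1E; apply: sumr_ge0 => i _; exact: sqr_ge0. Qed.

Lemma quad1_eq0 n (x : 'cV[R]_n) : (quad 1%:M x == 0) = (x == 0).
Proof.
apply/eqP/eqP => [|->]; last exact: quad0r.
rewrite quad1E => /eqP; rewrite psumr_eq0; last by move=> i _; exact: sqr_ge0.
move=> /allP x0; apply/matrixP => i j; rewrite (ord1 j) mxE; apply/eqP.
by have := x0 i; rewrite mem_index_enum sqrf_eq0 => /(_ isT).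
Qed.

Lemma quad1_gt0 n (x : 'cV[R]_n) : x != 0 -> 0 < quad 1%:M x.
Proof. by move=> x0; rewrite lt_def quad1_eq0 x0 quad1_ge0. Qed.

Lemma quad_line n (A : 'M[R]_n) (x y : 'cV[R]_n) t : A^T = A ->
  quad A (x + t *: y)
    = quad A x + 2 * t * (y^T *m A *m x) 0 0 + t ^+ 2 * quad A y.
Proof.
move=> symA.
have sym : (x^T *m A *m y) 0 0 = (y^T *m A *m x) 0 0.
  have -> : y^T *m A *m x = (x^T *m A *m y)^T by rewrite !trmx_mul trmxK symA mulmxA.
  by rewrite [RHS]mxE.
rewrite /quad [(x + _)^T]linearD /= [(t *: y)^T]linearZ /= !mulmxDl !mulmxDr.
rewrite -?scalemxAl -!scalemxAr -?scalemxAl.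
move: sym; rewrite /quad; move: (x^T *m A *m y) (y^T *m A *m x) => X Y XY.
by rewrite !mxE XY; ring.
Qed.

(** The zeros of a positive semidefinite quadratic form lie in the kernel of
    its matrix: at such a zero the form is minimal, hence stationary. *)
Lemma psd_quad_eq0 n (A : 'M[R]_n) (x : 'cV[R]_n) :
  psd A -> quad A x = 0 -> A *m x = 0.
Proof.
move=> [symA posA] Ax0; apply/eqP; rewrite -quad1_eq0.
set s := quad 1%:M (A *m x).
set c := quad A (A *m x).
have cge0 : 0 <= c := posA _.
have sge0 : 0 <= s := quad1_ge0 _.
have sE : ((A *m x)^T *m A *m x) 0 0 = s by rewrite /s /quad mulmx1 mulmxA.
have := posA (x + (- s / (c + 1)) *: (A *m x)).
rewrite quad_line// Ax0 add0r sE -/c => le0.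
have c1 : 0 < c + 1 by rewrite ltr_wpDl.
rewrite eq_le sge0 andbT leNgt; apply/negP => sgt0.
suff : 2 * (- s / (c + 1)) * s + (- s / (c + 1)) ^+ 2 * c < 0.
  by rewrite ltNge le0.
have -> : 2 * (- s / (c + 1)) * s + (- s / (c + 1)) ^+ 2 * c
    = - (s ^+ 2 * (c + 2) / (c + 1) ^+ 2).
  by field; rewrite lt0r_neq0.
by rewrite oppr_lt0 divr_gt0 ?exprn_gt0// mulr_gt0 ?exprn_gt0//; lra.
Qed.

Lemma continuous_sumr (T : topologicalType) n (f : 'I_n -> T -> R) :
  (forall i, continuous (f i)) -> continuous (fun x => \sum_i f i x).
Proof.
move=> cf x; pose xF := @nbhs_filter T x.
by apply: (cvg_big _ xF) => [|i _]; [exact: add_continuous | exact: cf].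
Qed.

Lemma quad_rV_continuous n (A : 'M[R]_n) :
  continuous (fun u : 'rV[R]_n => quad A u^T).
Proof.
have -> : (fun u : 'rV[R]_n => quad A u^T) =
    (fun u => \sum_j (\sum_i u 0 i * A i j) * u 0 j).
  apply/funext => w; rewrite quadE; apply: eq_bigr => j _; rewrite mxE.
  by congr (_ * _); apply: eq_bigr => i _; rewrite mxE.
apply: continuous_sumr => j u; apply: continuousM; last exact: coord_continuous.
apply: continuous_sumr => i {}u.
by apply: continuousM; [exact: coord_continuous | exact: cst_continuous].
Qed.

(** The maximum of the Rayleigh quotient of [D] relative to a positive definite
    [M], attained on the unit sphere, is a generalized eigenvalue. *)
Lemma rayleigh_max n (M D : 'M[R]_n) : (0 < n)%N -> posdef M -> D^T = D ->
  exists (mu : R) (x : 'cV[R]_n),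
    [/\ x != 0, D *m x = mu *: (M *m x) & psd (mu *: M - D)].
Proof.
case: n M D => // n M D _ [symM posM] symD.
pose sphere := [set u : 'rV[R]_n.+1 | quad 1%:M u^T = 1]%classic.
pose f (u : 'rV[R]_n.+1) := quad D u^T / quad M u^T.
have nz u : sphere u -> u^T != 0.
  move=> su; apply/eqP => u0; move: su; rewrite /sphere /= u0 quad0r.
  by move/eqP; rewrite eq_sym oner_eq0.
have sphere0 : (sphere !=set0)%classic.
  exists (delta_mx 0 0); rewrite /sphere /= quad1E big_ord_recl /= big1 => [|i _].
    by rewrite !mxE !eqxx /= expr1n addr0.
  by rewrite !mxE /= expr0n.
have csphere : compact sphere.
  apply: bounded_closed_compact.
    exists 1; split=> // r r1 u su; apply: ltW; apply: le_lt_trans r1.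
    rewrite [leLHS]/Num.norm /= mx_normrE; apply/bigmax_leP; split => //= -[i j] _ /=.
    rewrite -(@expr_le1 _ 2)// -normrX ger0_norm ?sqr_ge0//.
    move: su; rewrite /sphere /= quad1E => <-.
    rewrite (bigD1 j)//= mxE (ord1 i) lerDl; apply: sumr_ge0 => k _.
    exact: sqr_ge0.
  rewrite (_ : sphere = (fun u => quad 1%:M u^T) @^-1` [set x | x = 1])%classic//.
  apply: preimage_closed => [u _|]; first exact: (@quad_rV_continuous _ 1%:M u).
  exact: closed_eq.
have cf : {within sphere, continuous f}%classic.
  apply: continuous_in_subspaceT => u; rewrite inE => su.
  have cD : {for u, continuous (fun u : 'rV[R]_n.+1 => quad D u^T)}.
    exact: quad_rV_continuous.
  have cM : {for u, continuous (fun u : 'rV[R]_n.+1 => quad M u^T)}.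
    exact: quad_rV_continuous.
  by apply: (continuousM cD); apply: continuousV cM; rewrite gt_eqF// posM// nz.
have [u] := compact_EVT_max sphere0 csphere cf.
rewrite inE => su umax; pose mu := f u.
have Mu0 : 0 < quad M u^T by rewrite posM// nz.
have psdmu : psd (mu *: M - D).
  split=> [|x]; first by rewrite linearB linearZ /= symM symD.
  have [->|x0] := eqVneq x 0; first by rewrite quad0r.
  have x1 := quad1_gt0 x0.
  have Mx0 := posM _ x0.
  pose c := (Num.sqrt (quad 1%:M x))^-1.
  have c0 : c != 0 by rewrite invr_eq0 lt0r_neq0// sqrtr_gt0.
  have scx : sphere (c *: x)^T.
    rewrite /sphere /= trmxK quadZr /c exprVn sqr_sqrtr ?ltW// mulVf//.
    by rewrite lt0r_neq0.
  have := umax (c *: x)^T; rewrite inE => /(_ scx).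
  rewrite /f trmxK !quadZr -/(f u) -/mu -mulf_div divff ?sqrf_eq0// mul1r.
  by rewrite ler_pdivrMr// quadDl quadNl quadZl subr_ge0.
exists mu, u^T; split => //; first exact: nz.
have /(psd_quad_eq0 psdmu) : quad (mu *: M - D) u^T = 0.
  by rewrite quadDl quadNl quadZl /mu /f divfK ?subrr// lt0r_neq0.
by rewrite mulmxBl -scalemxAl => /eqP; rewrite subr_eq0 => /eqP ->.
Qed.

Lemma mx11_scalar_eq (A : 'M[R]_1) (c : R) : A 0 0 = c -> A = c%:M.
Proof. by move=> <-; exact: mx11_scalar. Qed.

(** A nonzero column extends to an invertible matrix. *)
Lemma unitmx_first_col n (x : 'cV[R]_(1 + n)) : x != 0 ->
  exists W : 'M[R]_(1 + n, n), row_mx x W \in unitmx.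
Proof.
move=> x0; pose E := row_ebase x^T.
pose c := (col_ebase x^T) 0 0.
have rk1 : \rank x^T = 1%N.
  apply/eqP; rewrite eqn_leq rank_leq_row lt0n mxrank_eq0.
  by rewrite -(inj_eq trmx_inj) trmxK trmx0.
have xE : x = c *: lsubmx E^T.
  rewrite -[LHS]trmxK -[x^T]mulmx_ebase rk1 [col_ebase _]mx11_scalar -/c.
  rewrite mul_scalar_mx -scalemxAl linearZ /= trmx_mul pid_mx_row tr_row_mx.
  by rewrite trmx1 trmx0 -/E -[E^T in LHS]hsubmxK mul_row_col mulmx1 mulmx0 addr0.
have c0 : c != 0 by apply: contraNneq x0 => c0; rewrite xE c0 scale0r.
exists (rsubmx E^T).
have -> : row_mx x (rsubmx E^T) = E^T *m block_mx c%:M 0 0 1%:M.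
  rewrite -[E^T in RHS]hsubmxK mul_row_block !mulmx0 addr0 add0r mulmx1.
  by rewrite mul_mx_scalar -xE.
rewrite unitmx_mul unitmx_tr row_ebase_unit /= unitmxE det_ublock det_scalar1.
by rewrite det1 mulr1 unitfE.
Qed.

(** Simultaneous diagonalization of a positive definite and a symmetric matrix
    by congruence. *)
Lemma pencil_diag n (M D : 'M[R]_n) : posdef M -> D^T = D ->
  exists (S : 'M[R]_n) (b : 'rV[R]_n),
    [/\ S \in unitmx, S^T *m M *m S = 1%:M & S^T *m D *m S = diag_mx b].
Proof.
elim: n M D => [|n IHn] M D pdM symD.
  by exists 1%:M, 0; split; [exact: unitmx1| |]; apply/matrixP => -[].
have [symM posM] := pdM.
have [mu [x [x0 Dx _]]] := rayleigh_max (ltn0Sn n) pdM symD.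
wlog x1 : x x0 Dx / quad M x = 1.
  move=> /(_ ((Num.sqrt (quad M x))^-1 *: x)); apply.
  - by rewrite scaler_eq0 negb_or x0 invr_eq0 sqrtr_eq0 -ltNge posM.
  - by rewrite -!scalemxAr Dx !scalerA mulrC.
  - rewrite quadZr exprVn sqr_sqrtr ?ltW ?posM// mulVf// lt0r_neq0//.
    exact: posM.
rewrite -[n.+1]/(1 + n)%N in M D pdM symD symM posM x x0 Dx x1 *.
have [V uV] := unitmx_first_col x0.
have xMx : x^T *m M *m x = 1%:M by exact: mx11_scalar_eq.
pose r := x^T *m M *m V.
(* The remaining columns are made M-orthogonal to x. *)
pose W := V - x *m r.
have xMW : x^T *m M *m W = 0 by rewrite mulmxBr mulmxA xMx mul1mx subrr.
pose U := row_mx x W.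
have uU : U \in unitmx.
  have -> : U = row_mx x V *m block_mx 1%:M (- r) 0 1%:M.
    rewrite mul_row_block mulmx0 !mulmx1 addr0 /U /W; congr row_mx.
    by rewrite mulmxN addrC.
  by rewrite unitmx_mul uV unitmxE det_ublock !det1 mulr1 unitr1.
have WMx : W^T *m M *m x = 0.
  by rewrite -[RHS]trmx0 -xMW !trmx_mul trmxK symM mulmxA.
have UMU : U^T *m M *m U = block_mx 1%:M 0 0 (W^T *m M *m W).
  by rewrite tr_row_mx mul_col_mx mul_col_row xMx xMW WMx.
have WDx : W^T *m D *m x = 0.
  by rewrite -mulmxA Dx -scalemxAr mulmxA WMx scaler0.
have xDW : x^T *m D *m W = 0.
  by rewrite -[RHS]trmx0 -WDx !trmx_mul trmxK symD mulmxA.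
have UDU : U^T *m D *m U = block_mx mu%:M 0 0 (W^T *m D *m W).
  rewrite tr_row_mx mul_col_mx mul_col_row WDx xDW; congr block_mx.
  by rewrite -mulmxA Dx -scalemxAr mulmxA xMx scalemx1.
have [||S [b [uS SMS SDS]]] := IHn (W^T *m M *m W) (W^T *m D *m W).
- split=> [|y y0]; first by rewrite !trmx_mul trmxK symM mulmxA.
  rewrite -quad_mulmx; apply: posM; apply: contraNneq y0 => Wy.
  have /(congr1 (mulmx (invmx U))) : U *m col_mx 0 y = 0.
    by rewrite mul_row_col mulmx0 add0r.
  by rewrite mulKmx// mulmx0 => /eqP; rewrite col_mx_eq0 => /andP[].
- by rewrite !trmx_mul trmxK symD mulmxA.
exists (U *m block_mx 1%:M 0 0 S), (row_mx mu%:M b).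
have congrE A (a : R) B : U^T *m A *m U = block_mx a%:M 0 0 B ->
    (U *m block_mx 1%:M 0 0 S)^T *m A *m (U *m block_mx 1%:M 0 0 S)
      = block_mx a%:M 0 0 (S^T *m B *m S).
  move=> UAU; rewrite trmx_mul -[_ *m A]mulmxA -[_ *m (_ *m A) *m _]mulmxA.
  rewrite (mulmxA _ U) UAU (tr_block_mx 1%:M) !trmx0 trmx1 !mulmx_block.
  by rewrite !mulmx0 !mul0mx !mulmx1 !mul1mx !addr0 !add0r !mulmx0 mulmxA.
split.
- by rewrite unitmx_mul uU unitmxE det_ublock det1 mul1r -unitmxE.
- by rewrite (congrE _ _ _ UMU) SMS -scalar_mx_block.
- rewrite (congrE _ _ _ UDU) SDS diag_mx_row; congr block_mx.
  by apply/matrixP => i j; rewrite !mxE !ord1.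
Qed.

End Quadratic.

(** * Positive semidefinite matrices and the Loewner order *)

Section Psd.
Context {R : realType}.

Lemma posdef_psd n (A : 'M[R]_n) : posdef A -> psd A.
Proof.
move=> [symA posA]; split=> // x.
have [->|x0] := eqVneq x 0; first by rewrite quad0r.
by rewrite ltW// posA.
Qed.

Lemma psd0 n : psd (0 : 'M[R]_n).
Proof. by split=> [|x]; rewrite ?trmx0// /quad mulmx0 mul0mx mxE. Qed.

Lemma psdD n (A B : 'M[R]_n) : psd A -> psd B -> psd (A + B).
Proof.
move=> [symA posA] [symB posB]; split=> [|x]; first by rewrite linearD /= symA symB.
by rewrite quadDl addr_ge0.
Qed.

Lemma psdZ n c (A : 'M[R]_n) : 0 <= c -> psd A -> psd (c *: A).
Proof.
move=> c0 [symA posA]; split=> [|x]; first by rewrite linearZ /= symA.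
by rewrite quadZl mulr_ge0.
Qed.

Lemma psd_congr m n (A : 'M[R]_n) (B : 'M[R]_(n, m)) : psd A -> psd (B^T *m A *m B).
Proof.
move=> [symA posA]; split=> [|x]; first by rewrite !trmx_mul trmxK symA mulmxA.
by rewrite -quad_mulmx.
Qed.

Lemma psd_convex m (A B : 'M[R]_m) r : 0 <= r <= 1 -> psd A -> psd B ->
  psd ((1 - r) *: A + r *: B).
Proof.
by move=> /andP[r0 r1] pA pB; apply: psdD; apply: psdZ => //; rewrite subr_ge0.
Qed.

Lemma psd_scalar n c : 0 <= c -> psd (c%:M : 'M[R]_n).
Proof.
move=> c0; split=> [|x]; first exact: tr_scalar_mx.
by rewrite quad_scalar mulr_ge0// quad1_ge0.
Qed.

Lemma psd_gram m n (B : 'M[R]_(m, n)) : psd (B^T *m B).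
Proof. by rewrite -[B^T]mulmx1; apply/psd_congr/psd_scalar. Qed.

Lemma loewner_refl n (A : 'M[R]_n) : loewner_le A A.
Proof. by rewrite /loewner_le subrr; exact: psd0. Qed.

Lemma loewner_scalar_posdef n c (A : 'M[R]_n) :
  0 < c -> loewner_le c%:M A -> posdef A.
Proof.
move=> c0 cA; split=> [|x x0].
  have [] := cA; rewrite linearB /= tr_scalar_mx => /eqP.
  by rewrite (inj_eq (addIr _)) => /eqP.
have [_ /(_ x)] := cA; rewrite quadDl quadNl quad_scalar subr_ge0.
by apply: lt_le_trans; rewrite mulr_gt0// quad1_gt0.
Qed.

Lemma quad_delta n (A : 'M[R]_n) i : quad A (delta_mx i 0) = A i i.
Proof.
rewrite quadE (bigD1 i)//= [X in _ + X]big1 => [|j /negbTE ji].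
  rewrite (bigD1 i)//= big1 => [|j /negbTE ji]; rewrite !mxE.
    by rewrite !eqxx mul1r addr0 mulr1 addr0.
  by rewrite ji mul0r.
by rewrite [delta_mx i 0 j 0]mxE ji mulr0.
Qed.

Lemma psd_diag_ge0 n (A : 'M[R]_n) i : psd A -> 0 <= A i i.
Proof. by move=> [_ posA]; rewrite -quad_delta. Qed.

Lemma posdef_unit n (A : 'M[R]_n) : posdef A -> A \in unitmx.
Proof.
move=> pdA; have [S [b [uS SAS _]]] := pencil_diag pdA (trmx0 R n n).
have : S^T *m A *m S \in unitmx by rewrite SAS unitmx1.
by rewrite !unitmx_mul => /andP[/andP[]].
Qed.

Lemma posdef_det_gt0 n (A : 'M[R]_n) : posdef A -> 0 < \det A.
Proof.
move=> pdA; have [S [b [uS /(congr1 (fun M => \det M)) + _]]] :=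
  pencil_diag pdA (trmx0 R n n).
rewrite !det_mulmx det_tr det1 mulrAC -expr2 => dA.
have : 0 < \det S ^+ 2 * \det A by rewrite dA ltr01.
by rewrite pmulr_rgt0// exprn_even_gt0//= -unitfE -unitmxE.
Qed.

Lemma posdef_invmx n (A : 'M[R]_n) : posdef A -> posdef (invmx A).
Proof.
move=> pdA; have [symA posA] := pdA; have uA := posdef_unit pdA.
split=> [|x x0]; first by rewrite trmx_inv symA.
have -> : x = A *m (invmx A *m x) by rewrite mulKVmx.
rewrite quad_mulmx symA mulmxV// mul1mx posA//.
by apply: contraNneq x0 => /(congr1 (mulmx A)); rewrite mulKVmx// mulmx0 => ->.
Qed.

(** The trace of a product of two positive semidefinite matrices is
    nonnegative, although the product need not be symmetric. *)
Lemma mxtrace_psd_mul_ge0 n (A B : 'M[R]_n) : psd A -> psd B -> 0 <= \tr (A *m B).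
Proof.
move=> psdA psdB; have [symA _] := psdA.
have pd1 : posdef (1%:M : 'M[R]_n).
  by apply: (loewner_scalar_posdef ltr01); exact: loewner_refl.
have [S [b [uS]]] := pencil_diag pd1 symA; rewrite mulmx1 => SS SAS.
have SSt : S *m S^T = 1%:M by apply: mulmx1C.
have -> : A = S *m diag_mx b *m S^T.
  by rewrite -SAS !mulmxA SSt mul1mx -mulmxA SSt mulmx1.
rewrite -!mulmxA mxtrace_mulC -!mulmxA; set C := S^T *m _.
have psdC : psd C by rewrite /C mulmxA; exact: psd_congr.
rewrite mul_diag_mx; apply: sumr_ge0 => i _; rewrite mxE mulr_ge0 ?psd_diag_ge0//.
by have := psd_diag_ge0 i (psd_congr S psdA); rewrite SAS !mxE eqxx mulr1n.
Qed.

Lemma frob_normE m n (A : 'M[R]_(m, n)) : frob_norm A ^+ 2 = \tr (A^T *m A).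
Proof.
rewrite /frob_norm sqr_sqrtr; last first.
  by do 2![apply: sumr_ge0 => ? _]; exact: sqr_ge0.
rewrite exchange_big; apply: eq_bigr => j _; rewrite !mxE; apply: eq_bigr => i _.
by rewrite !mxE expr2.
Qed.

Lemma frob_norm_ge0 m n (A : 'M[R]_(m, n)) : 0 <= frob_norm A.
Proof. exact: sqrtr_ge0. Qed.

Lemma sqr_frob_normZ m n c (A : 'M[R]_(m, n)) :
  frob_norm (c *: A) ^+ 2 = c ^+ 2 * frob_norm A ^+ 2.
Proof.
rewrite !frob_normE [(c *: A)^T]linearZ /= -scalemxAl -scalemxAr !mxtraceZ.
by rewrite mulrA expr2.
Qed.

Lemma frob_norm_diag_ge n (A : 'M[R]_n) c : 0 <= c -> (forall i, c <= A i i) ->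
  n%:R * c ^+ 2 <= frob_norm A ^+ 2.
Proof.
move=> c0 cA; rewrite frob_normE mulr_natl -[X in _ *+ X]card_ord -sumr_const.
apply: ler_sum => i _; rewrite mxE (bigD1 i)//= mxE -expr2.
rewrite ler_wpDr//; last by rewrite lerXn2r ?nnegrE ?cA// (le_trans c0).
by apply: sumr_ge0 => j _; rewrite mxE -expr2 sqr_ge0.
Qed.

(** The Frobenius norm is monotone for the two-sided Loewner bound
    [- E <= D <= E], because [tr (E^2) - tr (D^2) = tr ((E - D) (E + D))]. *)
Lemma loewner_frob_norm n (D E : 'M[R]_n) :
  loewner_le (- E) D -> loewner_le D E -> frob_norm D ^+ 2 <= frob_norm E ^+ 2.
Proof.
rewrite /loewner_le opprK => psdDE psdED.
have [symDE _] := psdDE; have [symED _] := psdED.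
have symD : D^T = D.
  apply/matrixP => i j; move/matrixP/(_ i j): symDE; move/matrixP/(_ i j): symED.
  by rewrite !mxE; lra.
have symE : E^T = E by have := symED; rewrite linearB /= symD => /addIr.
rewrite !frob_normE symD symE -subr_ge0.
have := mxtrace_psd_mul_ge0 psdED psdDE.
rewrite mulmxBl !mulmxDr linearB /= !mxtraceD (mxtrace_mulC E D).
by congr (0 <= _); ring.
Qed.

(** If [M >= kappa I], the form [D |-> tr (M^-1 D M^-1 D)] is at most
    [kappa^-2] times the squared Frobenius norm. *)
Lemma mxtrace_invmx_sq_le n (M D : 'M[R]_n) kappa : 0 < kappa ->
  loewner_le kappa%:M M -> D^T = D ->
  \tr (invmx M *m D *m (invmx M *m D)) <= frob_norm D ^+ 2 / kappa ^+ 2.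
Proof.
move=> k0 kM symD; have pdM := loewner_scalar_posdef k0 kM.
have uM := posdef_unit pdM; have [symM _] := pdM.
set W := invmx M; have pdW : posdef W := posdef_invmx pdM.
have psdW := posdef_psd pdW; have [symW _] := pdW.
have psdkW : psd (kappa^-1%:M - W).
  (* Congruence by M turns the claim into kappa^-1 M^2 - M >= 0. *)
  have -> : kappa^-1%:M - W = W^T *m (kappa^-1 *: (M *m M) - M) *m W.
    rewrite symW mulmxBr mulmxBl mulVmx// mul1mx -scalemxAr -scalemxAl mulmxA.
    by rewrite mulVmx// mul1mx mulmxV// scalemx1.
  apply: psd_congr; set N := M - kappa%:M.
  have -> : kappa^-1 *: (M *m M) - M = kappa^-1 *: (N^T *m N) + N.
    have -> : N^T = N by rewrite linearB /= symM tr_scalar_mx.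
    rewrite {1}/N mulmxBl mul_scalar_mx {1}/N mulmxBr mul_mx_scalar !scalerBr.
    by rewrite !scalerA mulVf ?gt_eqF// !scale1r subrK.
  by apply: psdD => //; apply: psdZ (psd_gram _); rewrite invr_ge0 ltW.
have le1 : \tr (W *m D *m (W *m D)) <= kappa^-1 * \tr (D *m (W *m D)).
  have := mxtrace_psd_mul_ge0 psdkW (psd_congr D psdW).
  rewrite symD mulmxBl mul_scalar_mx linearB /= linearZ /= subr_ge0.
  by rewrite !mulmxA.
have le2 : \tr (D *m (W *m D)) <= kappa^-1 * \tr (D^T *m D).
  have := mxtrace_psd_mul_ge0 psdkW (psd_gram D^T).
  rewrite trmxK symD mulmxBl mul_scalar_mx linearB /= linearZ /= subr_ge0.
  by rewrite [X in X <= _ -> _]mxtrace_mulC -mulmxA [X in X <= _ -> _]mxtrace_mulC mulmxA.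
apply: (le_trans le1); rewrite frob_normE.
rewrite (_ : _ / _ = kappa^-1 * (kappa^-1 * \tr (D^T *m D))).
  by rewrite ler_pM2l ?invr_gt0.
by field; rewrite gt_eqF.
Qed.

(** The generalized eigenvalues of [(D, M)]: in the coordinates of
    [pencil_diag] the whole segment [M + t D] is diagonal. *)
Lemma pencil_spectrum n (M D : 'M[R]_n) : posdef M -> D^T = D ->
  exists b : 'rV[R]_n,
  [/\ forall t, \det (M + t *: D) = \det M * \prod_i (1 + t * b 0 i),
      forall t, posdef (M + t *: D) -> forall i, 0 < 1 + t * b 0 i,
      \tr (invmx M *m D) = \sum_i b 0 i,
      forall t, posdef (M + t *: D) ->
        \tr (invmx (M + t *: D) *m D *m (invmx (M + t *: D) *m D))
          = \sum_i (b 0 i / (1 + t * b 0 i)) ^+ 2 &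
      psd D -> forall i, 0 <= b 0 i].
Proof.
move=> pdM symD; have [S [b [uS SMS SDS]]] := pencil_diag pdM symD.
have detS : \det S != 0 by rewrite -unitfE -unitmxE.
have StS t : S^T *m (M + t *: D) *m S = diag_mx (\row_i (1 + t * b 0 i)).
  rewrite mulmxDr mulmxDl SMS -scalemxAr -scalemxAl SDS.
  apply/matrixP => i j; rewrite !mxE; case: eqP => _; first by rewrite !mulr1n.
  by rewrite !mulr0n mulr0 addr0.
have pos t : posdef (M + t *: D) -> forall i, 0 < 1 + t * b 0 i.
  move=> [_ pos] i; have -> : 1 + t * b 0 i = quad (M + t *: D) (S *m delta_mx i 0).
    by rewrite quad_mulmx StS quad_delta !mxE eqxx mulr1n.
  apply: pos; apply/eqP => /(congr1 (mulmx (invmx S))).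
  rewrite mulKmx// mulmx0 => /matrixP/(_ i 0); rewrite !mxE !eqxx => /eqP.
  by rewrite oner_eq0.
pose N t := invmx S *m (invmx (M + t *: D) *m D) *m S.
have NE t : posdef (M + t *: D) -> N t = diag_mx (\row_i (b 0 i / (1 + t * b 0 i))).
  move=> pdt; have ut := posdef_unit pdt.
  have : diag_mx (\row_i (1 + t * b 0 i)) *m N t = diag_mx b.
    rewrite -StS /N -!mulmxA (mulmxA S) mulmxV// mul1mx.
    by rewrite (mulmxA (M + _)) mulmxV// mul1mx mulmxA SDS.
  move=> /matrixP NE; apply/matrixP => i j; have := NE i j.
  rewrite mul_diag_mx !mxE => /(canRL (mulKf _)) ->; last by rewrite gt_eqF// pos.
  by case: eqP => [->|_]; rewrite ?mulr1n ?mulr0n ?mulr0// mulrC.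
have trN t : \tr (invmx (M + t *: D) *m D) = \tr (N t).
  by rewrite /N [RHS]mxtrace_mulC !mulmxA mulmxV// mul1mx.
exists b; split=> //.
- move=> t.
  have d0 : \det S ^+ 2 * \det M = 1.
    by have /(congr1 (fun M => \det M)) := SMS; rewrite !det_mulmx det_tr det1 => <-; ring.
  have /(congr1 (fun M => \det M)) := StS t.
  rewrite !det_mulmx det_tr det_diag => dt.
  apply: (mulfI (expf_neq0 2 detS)); rewrite mulrA d0 mul1r.
  rewrite -[RHS](_ : \det S * \det (M + t *: D) * \det S = _); first by ring.
  by rewrite dt; apply: eq_bigr => i _; rewrite mxE.
- have := trN 0; rewrite scale0r addr0 => ->.
  rewrite NE ?scale0r ?addr0// mxtrace_diag; apply: eq_bigr => i _.
  by rewrite mxE mul0r addr0 divr1.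
- move=> t pdt; set X := invmx _ *m D.
  have -> : \tr (X *m X) = \tr (N t *m N t).
    rewrite /N -/X -(mulmxA _ S) (mulmxA S) (mulmxA S) mulmxV// mul1mx.
    by rewrite mulmxA [RHS]mxtrace_mulC !mulmxA mulmxV// mul1mx.
  rewrite NE// mulmx_diag mxtrace_diag; apply: eq_bigr => i _.
  by rewrite !mxE expr2.
- move=> psdD' i; have := psd_diag_ge0 i (psd_congr S psdD').
  by rewrite SDS !mxE eqxx mulr1n.
Qed.

End Psd.

(** * The largest eigenvalue of a definite pencil *)

Section MaxEig.
Context {R : realType}.

(** The supremum defining [max_eig (M^-1 A)] is the maximum of the Rayleigh
    quotient of [A] relative to [M]; in particular it is not the default value
    taken by [sup] on empty or unbounded sets. *)
Lemma max_eig_pencil_gt0 n (M A : 'M[R]_n) : (0 < n)%N -> posdef M -> posdef A ->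
  0 < max_eig (invmx M *m A).
Proof.
move=> n0 pdM pdA; have [symM posM] := pdM; have [symA posA] := pdA.
have uM := posdef_unit pdM.
have [mu [x [x0 Ax [_ leM]]]] := rayleigh_max n0 pdM symA.
have mu0 : 0 < mu.
  have : 0 < mu * quad M x.
    have -> : mu * quad M x = quad A x by rewrite /quad -!mulmxA Ax -scalemxAr [RHS]mxE.
    exact: posA.
  by rewrite pmulr_lgt0// posM.
apply: (lt_le_trans mu0); apply: ub_le_sup => /=.
  exists mu => a /eigenvalueP[v vE v0].
  pose y := invmx M *m v^T.
  have vy : v = y^T *m M by rewrite trmx_mul trmxK trmx_inv symM mulmxKV.
  have y0 : y != 0 by apply: contraNneq v0 => y0; rewrite vy y0 trmx0 mul0mx.
  have := leM y; rewrite quadDl quadNl quadZl.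
  have -> : quad A y = a * quad M y.
    have yA : y^T *m A = a *: (y^T *m M).
      by rewrite -vy -vE vy -mulmxA mulKVmx.
    by rewrite /quad yA -scalemxAl mxE.
  by rewrite subr_ge0 ler_pM2r// posM.
apply/eigenvalueP; exists (x^T *m M); last first.
  apply: contraNneq x0 => /(congr1 trmx); rewrite trmx_mul trmxK symM trmx0.
  by move=> /(congr1 (mulmx (invmx M))); rewrite mulKmx// mulmx0 => ->.
rewrite mulmxA mulmxK// -{1}symA -trmx_mul Ax linearZ /= trmx_mul symM.
by [].
Qed.

End MaxEig.

(** * Relative entropy and a second-order Taylor bound *)

Section Entropy.
Context {R : realType}.

(** The relative entropy [a ln (a / b) - a + b] of two positive numbers. *)
Definition rel_entropy (a b : R) : R := a * ln a - a * ln b - a + b.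

Lemma rel_entropy_ge0 a b : 0 < a -> 0 < b -> 0 <= rel_entropy a b.
Proof.
move=> a0 b0; have : ln (b / a) <= b / a - 1.
  have := @le_ln1Dx _ (b / a - 1); rewrite addrCA subrr addr0; apply.
  by rewrite ltrBrDl subrr divr_gt0.
rewrite ln_div// -(ler_pM2l a0) !mulrBr mulr1 mulrCA divff ?gt_eqF// mulr1.
by rewrite /rel_entropy; lra.
Qed.

Lemma is_derive_affine (c t : R) : is_derive t 1 (fun u : R => 1 + u * c) c.
Proof.
have D := is_deriveD (is_derive_cst (1 : R) t (1 : R))
  (is_deriveZ c (is_derive_id t (1 : R))).
rewrite (_ : (fun u => _) = cst 1 + c \*: id).
  by apply: (is_derive_eq D); rewrite add0r /GRing.scale /= mulr1.
by apply/funext => u; rewrite /= mulrC.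
Qed.

Lemma is_derive_ln_affine (c t : R) : 0 < 1 + t * c ->
  is_derive t 1 (fun u : R => ln (1 + u * c)) (c / (1 + t * c)).
Proof.
move=> pos; rewrite mulrC.
apply: (@is_derive1_comp _ (@ln R) (fun u => 1 + u * c)).
  exact: is_derive1_ln.
exact: is_derive_affine.
Qed.

Lemma is_derive_rel_entropy (a b t : R) : 0 < 1 + t * a -> 0 < 1 + t * b ->
  is_derive t 1 (fun u => rel_entropy (1 + u * a) (1 + u * b))
    (a * (ln (1 + t * a) - ln (1 + t * b)) + b * (1 - (1 + t * a) / (1 + t * b))).
Proof.
move=> ta tb.
have da := is_derive_affine a t; have db := is_derive_affine b t.
have la := is_derive_ln_affine ta; have lb := is_derive_ln_affine tb.
have := is_deriveD
  (is_deriveB (is_deriveB (is_deriveM da la) (is_deriveM da lb)) da) db.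
move=> D; apply: (is_derive_eq D); rewrite /GRing.scale /=.
by field; rewrite !gt_eqF.
Qed.

(** Second derivative of the relative entropy of two affine functions that
    both equal 1 at the origin. *)
Lemma is_derive_rel_entropy2 (a b t : R) : 0 < 1 + t * a -> 0 < 1 + t * b ->
  is_derive t 1 (fun u : R => a * (ln (1 + u * a) - ln (1 + u * b))
                            + b * (1 - (1 + u * a) / (1 + u * b)))
    ((a - b) ^+ 2 / ((1 + t * a) * (1 + t * b) ^+ 2)).
Proof.
move=> ta tb.
have da := is_derive_affine a t; have db := is_derive_affine b t.
have la := is_derive_ln_affine ta; have lb := is_derive_ln_affine tb.
have tb0 : 1 + t * b != 0 by rewrite gt_eqF.
have dv := is_deriveV (f := fun u => 1 + u * b) tb0 db.
have := is_deriveD (is_deriveZ a (is_deriveB la lb))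
  (is_deriveZ b (is_deriveB (is_derive_cst (1 : R) t (1 : R)) (is_deriveM da dv))).
move=> D; apply: (is_derive_eq D); rewrite /GRing.scale /=.
by field; rewrite !gt_eqF.
Qed.

Lemma taylor2_le (f g h : R -> R) (K : R) :
  (forall t : R, 0 <= t <= 1 -> is_derive t 1 f (g t)) ->
  (forall t : R, 0 <= t <= 1 -> is_derive t 1 g (h t)) ->
  f 0 = 0 -> g 0 = 0 -> (forall t : R, 0 <= t <= 1 -> h t <= K) -> f 1 <= K / 2.
Proof.
have ndecr (F G : R -> R) : (forall t : R, 0 <= t <= 1 -> is_derive t 1 F (G t)) ->
    (forall t : R, 0 <= t <= 1 -> 0 <= G t) -> forall t : R, 0 <= t <= 1 -> F 0 <= F t.
  move=> FG G0 t /andP[t0 t1].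
  have in01 x : x \in `]0, 1[%R -> 0 <= x <= 1.
    by rewrite in_itv /= => /andP[/ltW-> /ltW->].
  apply: (@ger0_derive1_ndecr R F 0 1) => //.
  - by move=> x /in01 /FG[].
  - by move=> x /in01 x01; rewrite derive1E; have [_ ->] := FG x x01; exact: G0.
  - apply: derivable_within_continuous => x; rewrite in_itv /= => /FG[] //.
move=> fg gh f0 g0 hK.
have g_le t : 0 <= t <= 1 -> 0 <= K * t - g t.
  move=> t01; have := ndecr (fun u => K * u - g u) (fun u => K - h u) _ _ t t01.
  rewrite g0 mulr0 subr0; apply=> u u01; last by rewrite subr_ge0 hK.
  have D := is_deriveB (is_deriveZ K (is_derive_id u (1 : R))) (gh u u01).
  by apply: (is_derive_eq D); rewrite /GRing.scale /= mulr1.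
have := ndecr (fun u => K / 2 * u ^+ 2 - f u) (fun u => K * u - g u) _ g_le 1.
rewrite f0 expr0n mulr0 subr0 expr1n mulr1 subr_ge0 ler01 lexx; apply=> // u u01.
have D := is_deriveB (is_deriveZ (K / 2) (is_deriveX 2 (is_derive_id u (1 : R))))
  (fg u u01).
by apply: (is_derive_eq D); rewrite /GRing.scale /=; field.
Qed.

(** Second-order Taylor bound for a sum of relative entropies whose arguments
    move along segments starting at 1. *)
Lemma sum_rel_entropy_le n (a K : R) (b : 'I_n -> R) :
  (forall t : R, 0 <= t <= 1 -> 0 < 1 + t * a) ->
  (forall t : R, 0 <= t <= 1 -> forall i, 0 < 1 + t * b i) ->
  (forall t : R, 0 <= t <= 1 ->
     \sum_i (a - b i) ^+ 2 / ((1 + t * a) * (1 + t * b i) ^+ 2) <= K) ->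
  \sum_i rel_entropy (1 + a) (1 + b i) <= K / 2.
Proof.
move=> pa pb leK.
pose f t := \sum_i rel_entropy (1 + t * a) (1 + t * b i).
pose g t := \sum_i (a * (ln (1 + t * a) - ln (1 + t * b i))
                            + b i * (1 - (1 + t * a) / (1 + t * b i))).
have -> : \sum_i rel_entropy (1 + a) (1 + b i) = f 1.
  by apply: eq_bigr => i _; rewrite !mul1r.
apply: (@taylor2_le f g _ K) leK => [t t01|t t01||].
- have -> : f = \sum_i (fun u => rel_entropy (1 + u * a) (1 + u * b i)).
    by apply/funext => u; rewrite fct_sumE.
  by apply: is_derive_sum => i; apply: is_derive_rel_entropy; [exact: pa|exact: pb].
- have -> : g = \sum_i (fun u => a * (ln (1 + u * a) - ln (1 + u * b i))
                            + b i * (1 - (1 + u * a) / (1 + u * b i))).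
    by apply/funext => u; rewrite fct_sumE.
  by apply: is_derive_sum => i; apply: is_derive_rel_entropy2; [exact: pa|exact: pb].
- by apply: big1 => i _; rewrite !mul0r addr0 /rel_entropy ln1; ring.
- by apply: big1 => i _; rewrite !mul0r addr0 subrr divr1 subrr !mulr0 addr0.
Qed.

End Entropy.

(** * Gradient and Bregman divergence of the objective *)

Section DeriveLine.
Context {R : realType}.

(* Scalar multiplication on the field itself, as it arises from derivatives. *)
Lemma scaleRE (a b : R) : a *: b = a * b.
Proof. by []. Qed.

Lemma derive_line (V : normedModType R) (f : V -> R) (x v : V) :
  'D_v f x = 'D_1 (fun h : R => f (h *: v + x)) 0.
Proof.
rewrite /derive; set F := fun h => h^-1 *: _; set G := fun h => h^-1 *: _.
suff -> : F = G by [].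
by apply/funext => h; rewrite /F /G /= addr0 scale0r add0r [_%:A]mulr1.
Qed.

(** The determinant is affine in each entry, with the cofactor as slope. *)
Lemma det_line_delta n (M : 'M[R]_n) i j (h : R) :
  \det (M - h *: delta_mx i j) = \det M - h * cofactor M i j.
Proof.
rewrite (expand_det_row M i) (expand_det_row _ i).
have cofE k : cofactor (M - h *: delta_mx i j) i k = cofactor M i k.
  rewrite /cofactor; congr (_ * \det _); apply/matrixP => r s; rewrite !mxE.
  by rewrite eq_sym (negbTE (neq_lift _ _)) mulr0 subr0.
rewrite (bigD1 j)//= [in RHS](bigD1 j)//= cofE !mxE !eqxx mulr1.
rewrite mulrBl [RHS]addrAC; congr (_ + _); apply: eq_bigr => k /negbTE kj.
by rewrite cofE !mxE kj andbF mulr0 subr0.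
Qed.

Lemma ln_prod (I : finType) (F : I -> R) : (forall i, 0 < F i) ->
  ln (\prod_i F i) = \sum_i ln (F i).
Proof.
move=> F0.
have [] : 0 < \prod_i F i /\ ln (\prod_i F i) = \sum_i ln (F i); last by [].
elim/big_ind2 : _ => [|x a y b [x0 <-] [y0 <-]|//].
  by rewrite ln1.
by rewrite mulr_gt0// lnM.
Qed.

(** Derivative of [log det] along a positive semidefinite direction. *)
Lemma is_derive_ln_det n (M D : 'M[R]_n) : posdef M -> psd D ->
  is_derive (0 : R) 1 (fun h : R => ln (\det (M + h *: D))) (\tr (invmx M *m D)).
Proof.
move=> pdM psdD; have [symD _] := psdD.
have [b [detE _ trE _ /(_ psdD) b0]] := pencil_spectrum pdM symD.
have D0 : is_derive (0 : R) 1 (cst (ln (\det M)) + \sum_i (fun h => ln (1 + h * b 0 i)))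
    (\tr (invmx M *m D)).
  have D1 : is_derive (0 : R) 1 (\sum_i (fun h => ln (1 + h * b 0 i)))
      (\sum_i b 0 i / (1 + 0 * b 0 i)).
    apply: is_derive_sum => i; apply: is_derive_ln_affine.
    by rewrite mul0r addr0.
  apply: (is_derive_eq (is_deriveD (is_derive_cst _ _ _) D1)).
  by rewrite add0r trE; apply: eq_bigr => i _; rewrite mul0r addr0 divr1.
apply: near_eq_is_derive D0; pose B := \sum_i b 0 i.
have B0 : 0 <= B by exact: sumr_ge0.
near=> h.
have hB : `|h| < (1 + B)^-1.
  by near: h; apply: (@nbhs0_lt R R); rewrite invr_gt0 ltr_pwDl.
have pos i : 0 < 1 + h * b 0 i.
  have biB : b 0 i <= B.
    by rewrite /B (bigD1 i)//= lerDl sumr_ge0.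
  have : `|h| * b 0 i < 1.
    rewrite (le_lt_trans (ler_wpM2l (normr_ge0 _) biB))//.
    move: hB; rewrite -[X in _ < X]mul1r ltr_pdivlMr ?ltr_pwDl// mulrDr mulr1 => hB.
    by rewrite (le_lt_trans _ hB)// lerDr.
  have := ler_norm (- h); rewrite normrN => hN hb.
  have := ler_wpM2r (b0 i) hN; lra.
by rewrite /= fct_sumE detE lnM ?posrE ?posdef_det_gt0 ?prodr_gt0// ln_prod.
Unshelve. all: by end_near. Qed.

End DeriveLine.

Section Gradient.
Context {R : realType} {nx nw ny T N : nat}.
Variable d : design_data R nx nw ny T N.
Local Notation n := (xi_dim nx nw T).
Local Notation eps := (eps d).
Local Notation theta := (theta d).

(** The matrix [lambda Omega - P], which is at least [kappa I] on the feasible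
    set and through which [P] enters [J]. *)
Definition slack (v : var R nx nw T N) : 'M[R]_n := vlam v *: Omega d - vP v.

(** At a symmetric slack matrix the transpose is immaterial; it appears because
    [gradP] collects the partial derivatives over all square matrices. *)
Lemma gradPE v : 0 < \det (slack v) ->
  gradP d v = (vlam v * eps / 2) *: (invmx (slack v))^T.
Proof.
move=> detM; have uM : slack v \in unitmx by rewrite unitmxE unitfE gt_eqF.
apply/matrixP => i j; rewrite !mxE derive_line.
set M := slack v in detM uM *; set c := vlam v * eps / 2.
pose C := cofactor M i j.
have -> : (fun h => J d (h *: delta_mx i j + vP v) (vlam v) (vq v)) =
    cst (J d (vP v) (vlam v) (vq v) + c * ln (\det M))
    + (- c) \*: (@ln R \o (cst (\det M) - C \*: id)).
  apply/funext => h; rewrite /J /= -/(slack v) -/M -/c.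
  have -> : vlam v *: Omega d - (h *: delta_mx i j + vP v) = M - h *: delta_mx i j.
    by rewrite /M /slack opprD addrCA addrC.
  by rewrite det_line_delta -/C (mulrC h) !fctE /= !scaleRE; ring.
have D1 : is_derive (0 : R) 1 (cst (\det M) - C \*: id) (- C).
  apply: (is_derive_eq (is_deriveB (is_derive_cst _ _ _)
    (is_deriveZ C (is_derive_id (0 : R) (1 : R))))).
  by rewrite sub0r /= ?scaleRE mulr1.
have M0 : (cst (\det M) - C \*: id) 0 = \det M.
  by rewrite !fctE /= scaler0 subr0.
have D2 := @is_derive1_comp _ (@ln R) (cst (\det M) - C \*: id) 0 (\det M)^-1 (- C).
have -> : 'D_1 (cst (J d (vP v) (vlam v) (vq v) + c * ln (\det M))
    + (- c) \*: (@ln R \o (cst (\det M) - C \*: id))) 0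
    = 0 + (- c) *: ((\det M)^-1 * (- C)).
  have D3 := is_deriveD
    (is_derive_cst (J d (vP v) (vlam v) (vq v) + c * ln (\det M)) (0 : R) (1 : R))
    (is_deriveZ (- c) (D2 _ D1)).
  by have [|_ ->] := D3; first by rewrite M0; exact: is_derive1_ln.
by rewrite /invmx uM !mxE -/C /= ?scaleRE; ring.
Qed.

Lemma gradqE v : gradq d v = \col_i N%:R^-1.
Proof.
apply/matrixP => i j; rewrite !mxE derive_line.
have -> : (fun h => J d (vP v) (vlam v) (h *: delta_mx i 0 + vq v)) =
    cst (J d (vP v) (vlam v) (vq v)) + N%:R^-1 \*: id.
  apply/funext => h; rewrite !fctE /J /= -[RHS]addrA; congr (_ + _).
  rewrite scaleRE -mulrDr; congr (_ * _).
  under eq_bigr do rewrite !mxE.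
  rewrite big_split /= addrC; congr (_ + _).
  rewrite (bigD1 i)//= !eqxx /= mulr1 big1 ?addr0// => k /negbTE ->.
  by rewrite mulr0.
have D := is_deriveD (is_derive_cst (J d (vP v) (vlam v) (vq v)) (0 : R) (1 : R))
  (is_deriveZ N%:R^-1 (is_derive_id (0 : R) (1 : R))).
by have [_ ->] := D; rewrite add0r /= ?scaleRE mulr1.
Qed.

Lemma gradlamE v : 0 < eps -> 0 < vlam v -> posdef (slack v) -> psd (Omega d) ->
  gradlam d v = theta - eps / 2 * ln (\det (Sigma d))
    + eps * n%:R / 2 * (ln (vlam v * eps / 2) + 1)
    - eps / 2 * ln (\det (slack v))
    - vlam v * eps / 2 * \tr (invmx (slack v) *m Omega d).
Proof.
move=> e0 l0 pdM psdO; rewrite /gradlam derive1E derive_line.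
have DM := is_derive_ln_det pdM psdO.
set M := slack v in pdM DM *; set l := vlam v in l0 *.
have e20 : 0 < l * eps / 2 by rewrite divr_gt0// mulr_gt0.
pose A (h : R) := h + l.
have DA : is_derive (0 : R) 1 A 1.
  apply: (is_derive_eq (is_deriveD (is_derive_id (0 : R) (1 : R))
    (is_derive_cst l (0 : R) (1 : R)))).
  by rewrite addr0.
have DL : is_derive (0 : R) 1 (fun h : R => ln (A h * (eps / 2))) l^-1.
  have DB : is_derive (0 : R) 1 ((eps / 2) \*: A) (eps / 2).
    by apply: (is_derive_eq (is_deriveZ (eps / 2) DA)); rewrite /= ?scaleRE mulr1.
  have B0 : ((eps / 2) \*: A) 0 = l * eps / 2.
    by rewrite /A /= add0r /= ?scaleRE; ring.
  have D2 : is_derive (0 : R) 1 (@ln R \o ((eps / 2) \*: A)) l^-1.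
    apply: is_derive_eq.
      by apply: is_derive1_comp DB; rewrite B0; exact: is_derive1_ln.
    by field; rewrite !gt_eqF.
  rewrite (_ : (fun h => _) = @ln R \o ((eps / 2) \*: A))//.
  by apply/funext => h; rewrite /= mulrC.
pose f1 := (theta - eps / 2 * ln (\det (Sigma d))) \*: A.
pose f2 := (eps * n%:R / 2) \*: (A * (fun h : R => ln (A h * (eps / 2)))).
pose f3 := (eps / 2) \*: (A * (fun h : R => ln (\det (M + h *: Omega d)))).
have -> : (fun h => J d (vP v) (h *: 1 + l) (vq v)) =
    f1 + f2 - f3 + cst (N%:R^-1 * \sum_i vq v i 0).
  apply/funext => h; rewrite /J -[h *: 1]/(h * 1) mulr1 -[h + l]/(A h) !fctE.
  rewrite /f1 /f2 /f3 /= !fctE /= ?scaleRE.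
  have -> : A h *: Omega d - vP v = M + h *: Omega d.
    by rewrite /A scalerDl -addrA addrC.
  by rewrite [A h * (eps / 2)]mulrA; ring.
have D1 := is_deriveZ (theta - eps / 2 * ln (\det (Sigma d))) DA.
have D2 := is_deriveZ (eps * n%:R / 2) (is_deriveM DA DL).
have D3 := is_deriveZ (eps / 2) (is_deriveM DA DM).
have D := is_deriveD (is_deriveB (is_deriveD D1 D2) D3)
  (is_derive_cst (N%:R^-1 * \sum_i vq v i 0) (0 : R) (1 : R)).
have [_ ->] := D; rewrite /A !add0r scale0r !addr0 /= ?scaleRE mulrA.
by field; rewrite gt_eqF.
Qed.

Implicit Types u v w s : var R nx nw T N.

Lemma vPD u v : vP (u + v) = vP u + vP v. Proof. by []. Qed.
Lemma vlamD u v : vlam (u + v) = vlam u + vlam v. Proof. by []. Qed.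
Lemma vPB u v : vP (u - v) = vP u - vP v. Proof. by []. Qed.
Lemma vlamB u v : vlam (u - v) = vlam u - vlam v. Proof. by []. Qed.
Lemma vqB u v : vq (u - v) = vq u - vq v. Proof. by []. Qed.
Lemma vPZ (c : R) v : vP (c *: v) = c *: vP v. Proof. by []. Qed.
Lemma vlamZ (c : R) v : vlam (c *: v) = c * vlam v. Proof. by []. Qed.
Lemma vqZ (c : R) v : vq (c *: v) = c *: vq v. Proof. by []. Qed.
Lemma vP_gradJ v : vP (gradJ d v) = gradP d v. Proof. by []. Qed.
Lemma vlam_gradJ v : vlam (gradJ d v) = gradlam d v. Proof. by []. Qed.
Lemma vq_gradJ v : vq (gradJ d v) = gradq d v. Proof. by []. Qed.

Lemma var_dotBl u v w :
  var_dot (u - v) w = var_dot u w - var_dot v w :> R.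
Proof.
rewrite /var_dot vPB vlamB vqB linearB /= mulmxBl linearB /= mulrBl.
have -> : \sum_i (vq u - vq v) i 0 * vq w i 0
    = \sum_i vq u i 0 * vq w i 0 - \sum_i vq v i 0 * vq w i 0.
  by rewrite -sumrB; apply: eq_bigr => i _; rewrite !mxE mulrBl.
ring.
Qed.

Lemma var_dotZl (c : R) v w : var_dot (c *: v) w = c * var_dot v w.
Proof.
rewrite /var_dot vPZ vlamZ vqZ linearZ /= -scalemxAl mxtraceZ !mulrDr mulrA.
congr (_ + _); rewrite mulr_sumr; apply: eq_bigr => i _.
by rewrite mxE mulrA.
Qed.

Lemma slackD v s (r : R) :
  slack (v + r *: (s - v)) = slack v + r *: (slack s - slack v).
Proof.
rewrite /slack vPD vlamD vPZ vlamZ vPB vlamB.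
by apply/matrixP => i j; rewrite !mxE; ring.
Qed.

(** The Bregman divergence of [J]: since [J] is a linear function plus the
    perspective of [- log det], it is a sum of relative entropies over the
    generalized eigenvalues of the increment of the slack matrix. *)
Lemma bregman_J v v' (b : 'rV[R]_n) : 0 < eps ->
  0 < vlam v -> 0 < vlam v' -> posdef (slack v) -> psd (Omega d) ->
  (forall i, 0 < 1 + b 0 i) ->
  \det (slack v') = \det (slack v) * \prod_i (1 + b 0 i) ->
  \tr (invmx (slack v) *m (slack v' - slack v)) = \sum_i b 0 i ->
  Jv d v' - Jv d v - var_dot (v' - v) (gradJ d v)
    = eps * vlam v / 2 * \sum_i rel_entropy (vlam v' / vlam v) (1 + b 0 i).
Proof.
move=> e0 l0 l'0 pdM psdO b0 detE trE.
have detM := posdef_det_gt0 pdM.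
rewrite /var_dot vPB vlamB vqB vP_gradJ vlam_gradJ vq_gradJ.
rewrite gradPE// gradqE gradlamE//.
have -> : \tr ((vP v' - vP v)^T *m (vlam v * eps / 2 *: (invmx (slack v))^T))
    = vlam v * eps / 2 * ((vlam v' - vlam v) * \tr (invmx (slack v) *m Omega d)
       - \sum_i b 0 i).
  rewrite -scalemxAr mxtraceZ -trmx_mul mxtrace_tr -trE.
  have -> : vP v' - vP v = (vlam v' - vlam v) *: Omega d - (slack v' - slack v).
    by rewrite /slack scalerBl; apply/matrixP => i j; rewrite !mxE; ring.
  by rewrite mulmxBr -scalemxAr linearB /= mxtraceZ.
have -> : \sum_i (vq v' - vq v) i 0 * (\col_(_ < N) N%:R^-1) i 0
    = N%:R^-1 * \sum_i vq v' i 0 - N%:R^-1 * \sum_i vq v i 0 :> R.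
  rewrite -mulrBr -sumrB mulr_sumr; apply: eq_bigr => i _; rewrite !mxE; ring.
have lndetE : ln (\det (slack v')) = ln (\det (slack v)) + \sum_i ln (1 + b 0 i).
  by rewrite detE lnM ?posrE ?prodr_gt0// ln_prod.
rewrite /Jv /J -/(slack v) -/(slack v') lndetE.
have -> : \sum_i rel_entropy (vlam v' / vlam v) (1 + b 0 i) =
   n%:R * (vlam v' / vlam v * ln (vlam v' / vlam v) - vlam v' / vlam v + 1)
   - vlam v' / vlam v * \sum_i ln (1 + b 0 i) + \sum_i b 0 i.
  rewrite mulr_sumr mulr_natl -[X in _ *+ X]card_ord -sumr_const -sumrB -big_split /=.
  by apply: eq_bigr => i _; rewrite /rel_entropy; ring.
have -> : ln (vlam v' * eps / 2) = ln (vlam v' / vlam v) + ln (vlam v * eps / 2).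
  rewrite -lnM ?posrE ?divr_gt0 ?mulr_gt0//; congr ln.
  by field; rewrite gt_eqF.
move: (N%:R^-1) (vlam v) (vlam v') l0 l'0 => m l l' l0 l'0.
by field; rewrite gt_eqF.
Qed.

End Gradient.

(** * Curvature bound and the Frank-Wolfe recursion *)

Section ScalarBound.
Context {R : realType}.

(** Bound on the second derivative of [J] along a segment, in terms of the
    eigenvalues [beta] of the relative slack increment, the increment [h] of
    [lambda] and the current value [lam] of [lambda]. *)
Lemma sum_sqr_pencil_le n (beta : 'I_n -> R) (h lam lo up p kappa eps F G Y s : R) :
  (0 < n)%N -> 0 < lo -> lo <= lam <= up -> 0 < kappa -> 0 < eps ->
  0 <= p -> n%:R * kappa ^+ 2 <= p ^+ 2 ->
  \sum_i beta i ^+ 2 <= F / kappa ^+ 2 -> h ^+ 2 <= G -> 0 <= Y -> 0 <= s ->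
  eps / 2 * \sum_i (h - lam * beta i) ^+ 2 / lam <=
    (F + G + Y) * ((up * eps + 2 * eps * p + 2 * s) / (2 * kappa ^+ 2)
                   + n%:R * eps / (2 * lo)).
Proof.
move=> n0 lo0 /andP[lolam lamup] k0 e0 p_ge0 pn.
set S := \sum_i _ ^+ 2 => leF leG Y0 s0.
have N0 : 0 < n%:R :> R by rewrite ltr0n.
have k20 : 0 < kappa ^+ 2 by rewrite exprn_gt0.
have p0 : 0 < p.
  rewrite lt_def p_ge0 andbT; apply: contraTneq pn => ->.
  by rewrite expr0n /= -ltNge mulr_gt0.
have lam0 : 0 < lam := lt_le_trans lo0 lolam.
have up0 : 0 < up := lt_le_trans lam0 lamup.
have S0 : 0 <= S by apply: sumr_ge0 => i _; exact: sqr_ge0.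
have G0 : 0 <= G := le_trans (sqr_ge0 h) leG.
have F0 : 0 <= F.
  by have := le_trans S0 leF; rewrite pmulr_lge0// invr_gt0.
(* Weight of the inequality 2 |h beta| <= w h^2 + beta^2 / w that balances the
   two terms against the Frobenius norm p. *)
pose w := 2 * p / (n%:R * kappa ^+ 2).
have w0 : 0 < w by rewrite divr_gt0 ?mulr_gt0.
have wV : w^-1 <= 2 * p.
  rewrite /w invf_div ler_pdivrMr ?mulr_gt0//; nra.
have term i : (h - lam * beta i) ^+ 2 / lam <=
    h ^+ 2 * (lo^-1 + w) + (up + 2 * p) * beta i ^+ 2.
  have -> : (h - lam * beta i) ^+ 2 / lam
      = h ^+ 2 * lam^-1 - 2 * (h * beta i) + lam * beta i ^+ 2.
    by field; rewrite gt_eqF.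
  have h1 : h ^+ 2 * lam^-1 <= h ^+ 2 * lo^-1.
    by rewrite ler_wpM2l ?sqr_ge0// lef_pV2.
  have h2 : - 2 * (h * beta i) <= h ^+ 2 * w + w^-1 * beta i ^+ 2.
    rewrite -subr_ge0.
    have -> : h ^+ 2 * w + w^-1 * beta i ^+ 2 - - 2 * (h * beta i)
        = w * (h + beta i / w) ^+ 2 by field; rewrite gt_eqF.
    by rewrite mulr_ge0 ?sqr_ge0// ltW.
  have h3 : w^-1 * beta i ^+ 2 <= 2 * p * beta i ^+ 2.
    by rewrite ler_wpM2r ?sqr_ge0.
  have h4 : lam * beta i ^+ 2 <= up * beta i ^+ 2.
    by rewrite ler_wpM2r ?sqr_ge0.
  lra.
have sumle : \sum_i (h - lam * beta i) ^+ 2 / lam <=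
    n%:R * (G * (lo^-1 + w)) + (up + 2 * p) * (F / kappa ^+ 2).
  apply: (@le_trans _ _ (\sum_i (h ^+ 2 * (lo^-1 + w) + (up + 2 * p) * beta i ^+ 2))).
    by apply: ler_sum => i _; exact: term.
  rewrite big_split /= sumr_const card_ord -[X in X + _]mulr_natl -mulr_sumr lerD//.
    by rewrite ler_wpM2l// ler_wpM2r// addr_ge0 ?invr_ge0// ltW.
  by rewrite ler_wpM2l// addr_ge0 ?mulr_ge0// ltW.
have c0 : 0 <= eps / 2 by rewrite divr_ge0 ?ltW.
apply: (le_trans (ler_wpM2l c0 sumle)).
have -> : eps / 2 * (n%:R * (G * (lo^-1 + w)) + (up + 2 * p) * (F / kappa ^+ 2))
  = G * (n%:R * eps / (2 * lo)) + G * (2 * eps * p / (2 * kappa ^+ 2))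
    + F * ((up * eps + 2 * eps * p) / (2 * kappa ^+ 2)).
  by rewrite /w; field; rewrite !gt_eqF.
have -> : (up * eps + 2 * eps * p + 2 * s) / (2 * kappa ^+ 2) =
  up * eps / (2 * kappa ^+ 2) + 2 * eps * p / (2 * kappa ^+ 2) + s / kappa ^+ 2.
  by field; rewrite gt_eqF.
rewrite [X in F * X]mulrDl.
have a0 : 0 <= up * eps / (2 * kappa ^+ 2) by rewrite !(divr_ge0, mulr_ge0)// ltW.
have b0 : 0 <= 2 * eps * p / (2 * kappa ^+ 2) by rewrite !(divr_ge0, mulr_ge0)// ltW.
have s'0 : 0 <= s / kappa ^+ 2 by rewrite divr_ge0// ltW.
have n'0 : 0 <= n%:R * eps / (2 * lo) by rewrite !(divr_ge0, mulr_ge0)// ltW.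
move: (up * eps / _) (2 * eps * p / _) (s / _) (n%:R * eps / _) a0 b0 s'0 n'0.
move=> a b c e a0 b0' c0' e0'.
have := mulr_ge0 F0 c0'; have := mulr_ge0 F0 e0'.
have := mulr_ge0 G0 a0; have := mulr_ge0 G0 c0'.
have := mulr_ge0 Y0 (addr_ge0 (addr_ge0 (addr_ge0 a0 b0') c0') e0').
lra.
Qed.

End ScalarBound.

Section FrankWolfe.
Context {R : realType} {nx nw ny T N : nat}.
Variable d : design_data R nx nw ny T N.
Local Notation n := (xi_dim nx nw T).
Local Notation NX := (stacked T nx).
Local Notation NY := (stacked T ny).
Local Notation eps := (eps d).
Local Notation kappa := (kappa d).
Local Notation Omega := (Omega d).
Hypotheses (nx_gt0 : (0 < nx)%N) (Sigma_pd : posdef (Sigma d)).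
Hypotheses (eps_gt0 : 0 < eps) (kappa_gt0 : 0 < kappa).
Variable v0 : var R nx nw T N.
Implicit Types v s : var R nx nw T N.

Local Notation P_low := (P_low d).
Local Notation P_up := (P_up d v0).
Local Notation lam_low := (lam_low d).
Local Notation lam_up := (lam_up d v0).
Local Notation q_low := (q_low d v0).
Local Notation q_up := (q_up d v0).
Local Notation Sset := (Sset d v0).
Local Notation Sset_proj := (Sset_proj d v0).
Local Notation CJ := (curvature_bound d v0).

Lemma xi_dim_gt0 : (0 < n)%N.
Proof. by rewrite xi_dimE addn_gt0 nx_gt0. Qed.

Lemma Omega_ge1 : loewner_le 1%:M Omega.
Proof.
rewrite /loewner_le /Omega addrC addKr; apply: psdZ; first by rewrite divr_ge0// ltW.
exact/posdef_psd/posdef_invmx.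
Qed.

Lemma Omega_psd : psd Omega.
Proof. exact/posdef_psd/(loewner_scalar_posdef ltr01)/Omega_ge1. Qed.

Lemma P_low_psd : psd P_low.
Proof. by rewrite /P_low -[_ *m _ *m mp_inverse _]mulmxA; apply/psd_congr/psd_gram. Qed.

(** The lower bound on [lambda] keeps [J] away from its singularity at 0. *)
Lemma lam_low_gt0 : 0 < lam_low.
Proof.
have -> : lam_low = max_eig (invmx Omega *m (P_low + kappa%:M)).
  by rewrite /lam_low mulmxDr mul_mx_scalar.
apply: max_eig_pencil_gt0; first exact: xi_dim_gt0.
  exact/(loewner_scalar_posdef ltr01)/Omega_ge1.
apply: (loewner_scalar_posdef kappa_gt0).
by rewrite /loewner_le addrK; exact: P_low_psd.
Qed.

Lemma slack_ge v : Sset_proj v -> loewner_le kappa%:M (slack d v).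
Proof. by case=> Phi [_ _ _ _ []]. Qed.

Lemma slack_posdef v : Sset_proj v -> posdef (slack d v).
Proof. by move/slack_ge; exact: loewner_scalar_posdef. Qed.

Lemma vlam_itv v : Sset_proj v -> lam_low <= vlam v <= lam_up.
Proof. by case=> Phi []. Qed.

Lemma vlam_gt0 v : Sset_proj v -> 0 < vlam v.
Proof. by move/vlam_itv => /andP[+ _]; apply: lt_le_trans lam_low_gt0. Qed.

Lemma slack_le v : Sset_proj v -> loewner_le (slack d v) (P_up - P_low).
Proof.
move=> Sv; have /andP[_ lv] := vlam_itv Sv; have [Phi [Pv _ _ _ _]] := Sv.
rewrite /loewner_le.
have -> : P_up - P_low - slack d v
    = (lam_up - vlam v) *: Omega + kappa%:M + (vP v - P_low).
  by rewrite /Defs.P_up /slack scalerBl; apply/matrixP => i j; rewrite !mxE; ring.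
apply: psdD Pv; apply: psdD; last by apply: psd_scalar; exact: ltW.
by apply: psdZ Omega_psd; rewrite subr_ge0.
Qed.

(** The slack matrices of feasible points lie between 0 and [P_up - P_low], so
    their differences are no larger than the interval of the matrix bounds,
    although they also involve the increments of [lambda]. *)
Lemma slackB_frob_norm v s : Sset_proj v -> Sset_proj s ->
  frob_norm (slack d s - slack d v) ^+ 2 <= frob_norm (P_up - P_low) ^+ 2.
Proof.
move=> Sv Ss; have pv := posdef_psd (slack_posdef Sv).
have ps := posdef_psd (slack_posdef Ss); have lv := slack_le Sv; have ls := slack_le Ss.
apply: loewner_frob_norm; rewrite /loewner_le.
  by rewrite opprK -addrA [- _ + _]addrC; exact: psdD ps lv.
by rewrite opprB addrA [_ + slack d v]addrC -addrA; exact: psdD pv ls.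
Qed.

Lemma convex_itv (a b x y r : R) : 0 <= r <= 1 -> a <= x <= b -> a <= y <= b ->
  a <= (1 - r) * x + r * y <= b.
Proof.
move=> /andP[r0 r1] /andP[ax xb] /andP[ay yb].
by apply/andP; split; nra.
Qed.

Lemma blocks_lower_convex m p (A B : 'M[R]_(stacked T m, stacked T p)) r :
  blocks_lower A -> blocks_lower B -> blocks_lower ((1 - r) *: A + r *: B).
Proof.
move=> lA lB i j ij.
have /matrixP Aij := lA i j ij; have /matrixP Bij := lB i j ij.
apply/matrixP => a b; have := Aij a b; have := Bij a b.
by rewrite !mxE => -> ->; rewrite !mulr0 addr0.
Qed.

Lemma Sset_convex Phi Phi' v s r : 0 <= r <= 1 -> Sset Phi v -> Sset Phi' s ->
  Sset ((1 - r) *: Phi + r *: Phi') ((1 - r) *: v + r *: s).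
Proof.
move=> r01 [lPv uPv lamv qv [symv xiv Phiv kv [PhiRv lxv lyv]]].
move=> [lPs uPs lams qs [syms xis Phis ks [PhiRs lxs lys]]].
have cst m p (A : 'M[R]_(m, p)) : A = (1 - r) *: A + r *: A.
  by rewrite -scalerDl subrK scale1r.
have vPE : vP ((1 - r) *: v + r *: s) = (1 - r) *: vP v + r *: vP s by [].
have vlamE : vlam ((1 - r) *: v + r *: s) = (1 - r) * vlam v + r * vlam s by [].
have vqE : vq ((1 - r) *: v + r *: s) = (1 - r) *: vq v + r *: vq s by [].
have slackE : vlam ((1 - r) *: v + r *: s) *: Omega - vP ((1 - r) *: v + r *: s)
    = (1 - r) *: (vlam v *: Omega - vP v) + r *: (vlam s *: Omega - vP s).
  by rewrite vPE vlamE; apply/matrixP => i j; rewrite !mxE; ring.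
split.
- have := psd_convex r01 lPv lPs; rewrite /loewner_le vPE.
  by congr psd; apply/matrixP => i j; rewrite !mxE; ring.
- have := psd_convex r01 uPv uPs; rewrite /loewner_le vPE.
  by congr psd; apply/matrixP => i j; rewrite !mxE; ring.
- by rewrite vlamE; exact: convex_itv.
- move=> i; have -> : vq ((1 - r) *: v + r *: s) i 0 = (1 - r) * vq v i 0 + r * vq s i 0.
    by rewrite vqE !mxE.
  exact: convex_itv.
split.
- by rewrite vPE linearD /= !linearZ /= symv syms.
- move=> i; have := psd_convex r01 (xiv i) (xis i).
  rewrite !scale_block_mx add_block_mx -slackE vlamE vqE.
  congr psd; congr block_mx; apply/matrixP => a b; rewrite !mxE; ring.
- have := psd_convex r01 Phiv Phis.
  rewrite !scale_block_mx add_block_mx -cst vPE.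
  congr psd; congr block_mx; first by rewrite linearD !linearZ /= mulmxDr -!scalemxAr.
  by rewrite mulmxDl -!scalemxAl.
- have := psd_convex r01 kv ks; rewrite /loewner_le slackE.
  by congr psd; apply/matrixP => i j; rewrite !mxE; ring.
split.
- by rewrite mulmxDl -!scalemxAl PhiRv PhiRs -cst.
- by rewrite linearD !linearZ /=; exact: blocks_lower_convex.
- by rewrite linearD !linearZ /=; exact: blocks_lower_convex.
Qed.

Lemma Sset_proj_convex v s r : 0 <= r <= 1 -> Sset_proj v -> Sset_proj s ->
  Sset_proj (v + r *: (s - v)).
Proof.
move=> r01 [Phi SPhi] [Phi' SPhi']; exists ((1 - r) *: Phi + r *: Phi').
have -> : v + r *: (s - v) = (1 - r) *: v + r *: s.
  by rewrite scalerBr scalerBl scale1r addrCA addrC.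
exact: Sset_convex.
Qed.

(** Convexity of [J] on the feasible set, in gradient form. *)
Lemma J_ge_tangent v s : Sset_proj v -> Sset_proj s ->
  Jv d v + var_dot (s - v) (gradJ d v) <= Jv d s.
Proof.
move=> Sv Ss; have pv := slack_posdef Sv; have ps := slack_posdef Ss.
have symD : (slack d s - slack d v)^T = slack d s - slack d v.
  by rewrite linearB /= pv.1 ps.1.
have [b [detE pos trE _ _]] := pencil_spectrum pv symD.
have b0 i : 0 < 1 + b 0 i.
  by have := pos 1 _ i; rewrite scale1r addrC subrK mul1r; apply.
have lv := vlam_gt0 Sv; have ls := vlam_gt0 Ss.
rewrite -subr_ge0 opprD addrA (bregman_J eps_gt0 lv ls pv Omega_psd b0)//.
  apply: mulr_ge0; first by rewrite ltW// divr_gt0 ?mulr_gt0.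
  by apply: sumr_ge0 => i _; rewrite rel_entropy_ge0// divr_gt0.
have := detE 1; rewrite scale1r addrC subrK => ->.
by congr (_ * _); apply: eq_bigr => i _; rewrite mul1r.
Qed.

(** Quadratic upper bound on the Bregman divergence of [J] along a segment. *)
Lemma J_le_tangent v s r : Sset_proj v -> Sset_proj s -> 0 < r <= 1 ->
  Jv d (v + r *: (s - v)) - Jv d v
    - var_dot (v + r *: (s - v) - v) (gradJ d v) <= r ^+ 2 / 2 * CJ.
Proof.
move=> Sv Ss /andP[r0 r1]; have pv := slack_posdef Sv; have ps := slack_posdef Ss.
have lv := vlam_gt0 Sv.
set v' := v + r *: (s - v).
have Sv' : Sset_proj v' by apply: Sset_proj_convex => //; rewrite ltW.
have pv' := slack_posdef Sv'; have lv' := vlam_gt0 Sv'.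
pose D := slack d v' - slack d v.
have DE : D = r *: (slack d s - slack d v) by rewrite /D slackD addrC addKr.
have symD : D^T = D by rewrite linearB /= pv.1 pv'.1.
have [b [detE pos trE sqE _]] := pencil_spectrum pv symD.
pose a := (vlam v' - vlam v) / vlam v.
have inS t : 0 <= t <= 1 -> Sset_proj (v + t *: (v' - v)).
  by move=> t01; exact: Sset_proj_convex.
have slackt t : slack d v + t *: D = slack d (v + t *: (v' - v)) by rewrite slackD.
have lamt t : vlam (v + t *: (v' - v)) = vlam v * (1 + t * a).
  by rewrite vlamD vlamZ vlamB /a; field; rewrite gt_eqF.
have post t : 0 <= t <= 1 -> posdef (slack d v + t *: D).
  by move=> t01; rewrite slackt; exact/slack_posdef/inS.
have post' t : 0 <= t <= 1 -> forall i, 0 < 1 + t * b 0 i.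
  by move=> t01; exact/pos/post.
have posa t : 0 <= t <= 1 -> 0 < 1 + t * a.
  by move=> t01; rewrite -(pmulr_rgt0 _ lv) -lamt; exact/vlam_gt0/inS.
have one01 : 0 <= (1 : R) <= 1 by rewrite ler01 lexx.
have b0 i : 0 < 1 + b 0 i by have := post' 1 one01 i; rewrite mul1r.
rewrite (bregman_J eps_gt0 lv lv' pv Omega_psd b0)//; last first.
  have := detE 1; rewrite scale1r /D addrC subrK => ->.
  by congr (_ * _); apply: eq_bigr => i _; rewrite mul1r.
have -> : vlam v' / vlam v = 1 + a by rewrite /a; field; rewrite gt_eqF.
have c0 : 0 < eps * vlam v / 2 by rewrite divr_gt0// mulr_gt0.
rewrite -ler_pdivlMl//.
have -> : (eps * vlam v / 2)^-1 * (r ^+ 2 / 2 * CJ)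
  = ((eps * vlam v / 2)^-1 * (r ^+ 2 * CJ)) / 2 by field; rewrite !gt_eqF.
apply: sum_rel_entropy_le => // t t01.
rewrite ler_pdivlMl//.
have St := inS t t01; have /andP[lo up] := vlam_itv St.
have lt0 := vlam_gt0 St.
pose lt := vlam v * (1 + t * a); pose beta i := b 0 i / (1 + t * b 0 i).
have -> : eps * vlam v / 2 *
    (\sum_i (a - b 0 i) ^+ 2 / ((1 + t * a) * (1 + t * b 0 i) ^+ 2))
  = eps / 2 * \sum_i (vlam v * a - lt * beta i) ^+ 2 / lt.
  rewrite !mulr_sumr; apply: eq_bigr => i _; rewrite /lt /beta.
  have := posa t t01; have := post' t t01 i => B0 A0.
  by move: (vlam v) lv => l l0; field; rewrite !gt_eqF.
rewrite /curvature_bound [leRHS]mulrA.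
rewrite [X in _ <= X * _]mulrDr [X in _ <= (X + _) * _]mulrDr.
have p0 := frob_norm_ge0 P_up.
apply: sum_sqr_pencil_le => //.
- exact: xi_dim_gt0.
- exact: lam_low_gt0.
- by rewrite /lt -lamt lo up.
- apply: frob_norm_diag_ge => [|i]; first exact: ltW.
  rewrite /Defs.P_up mxE [X in X + _]mxE [X in _ + X]mxE eqxx mulr1n lerDr mulr_ge0//.
    by rewrite (le_trans _ (le_trans lo up))// ltW// lam_low_gt0.
  exact: psd_diag_ge0 Omega_psd.
- have := mxtrace_invmx_sq_le kappa_gt0 (slack_ge St) symD.
  rewrite -slackt sqE; last exact: post.
  move=> /le_trans; apply; rewrite ler_pM2r ?invr_gt0 ?exprn_gt0//.
  by rewrite DE sqr_frob_normZ ler_wpM2l ?sqr_ge0// slackB_frob_norm.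
- have -> : vlam v * a = r * (vlam s - vlam v).
    rewrite /a /v' vlamD vlamZ vlamB; field; rewrite gt_eqF//.
  rewrite exprMn ler_wpM2l ?sqr_ge0//.
  rewrite -normrX ger0_norm ?sqr_ge0//.
  have /andP[a1 a2] := vlam_itv Sv; have /andP[a3 a4] := vlam_itv Ss.
  have x1 : 0 <= lam_up - lam_low - (vlam s - vlam v) by lra.
  have x2 : 0 <= lam_up - lam_low + (vlam s - vlam v) by lra.
  by rewrite -subr_ge0 subr_sqr mulr_ge0.
- by rewrite mulr_ge0 ?sqr_ge0.
- exact: sqr_ge0.
Qed.

(** The set of Bregman quotients is bounded, so its supremum is a genuine one. *)
Lemma curvature_le v : Sset_proj v -> curvature d v0 <= CJ.
Proof.
move=> Sv; apply: ge_sup.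
  exists (2 / 1 ^+ 2 * (Jv d (v + 1 *: (v - v)) - Jv d v
    - var_dot (v + 1 *: (v - v) - v) (gradJ d v))), v, v, 1.
  by split=> //; rewrite ltr01 lexx.
move=> _ [w [s [r [Sw Ss r01 ->]]]]; have /andP[r0 r1] := r01.
have c0 : 0 <= 2 / r ^+ 2 by rewrite divr_ge0// exprn_ge0// ltW.
apply: (le_trans (ler_wpM2l c0 (J_le_tangent Sw Ss r01))).
rewrite mulrA (_ : 2 / r ^+ 2 * (r ^+ 2 / 2) = 1) ?mul1r//.
by field; rewrite gt_eqF.
Qed.

Lemma curvature_bound_ge0 v : Sset_proj v -> 0 <= CJ.
Proof.
move=> Sv; have r01 : 0 < (1 : R) <= 1 by rewrite ltr01 lexx.
have := J_le_tangent Sv Sv r01.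
have -> : v + 1 *: (v - v) = v by rewrite subrr scaler0 addr0.
by rewrite var_dotBl !subrr expr1n pmulr_rge0// divr_gt0.
Qed.

Lemma step_size_itv (k : nat) : 0 < (step_size k : R) <= 1.
Proof.
have k2 : 0 < k%:R + 2 :> R by rewrite ltr_wpDl.
by rewrite /step_size divr_gt0 ?ler_pdivrMr ?mul1r ?lerDr ?ler0n.
Qed.

(** One inexact Frank-Wolfe step contracts the optimality gap by [1 - rho] up
    to a term of order [rho ^ 2]. *)
Lemma fw_step_gap (gamma0 : R) k v s Phi v_star : 0 <= gamma0 ->
  Sset_proj v -> Sset_proj v_star -> fw_direction d v0 gamma0 k v Phi s ->
  Sset_proj (fw_next k v s) /\
  Jv d (fw_next k v s) - Jv d v_star <=
    (1 - step_size k) * (Jv d v - Jv d v_star)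
    + step_size k ^+ 2 / 2 * (CJ * (1 + gamma0)).
Proof.
move=> g0 Sv [Phi' Sstar] [Ss opt]; set r := step_size k.
have r01 : 0 < r <= 1 := step_size_itv k; have /andP[r0 r1] := r01.
have Ssp : Sset_proj s by exists Phi.
have Sstar' : Sset_proj v_star by exists Phi'.
have nextE : fw_next k v s = v + r *: (s - v).
  by rewrite /fw_next -/r scalerBr scalerBl scale1r addrAC addrA.
rewrite nextE; split; first by apply: Sset_proj_convex => //; rewrite ltW.
have := J_le_tangent Sv Ssp r01.
have -> : v + r *: (s - v) - v = r *: (s - v) by rewrite addrC addKr.
rewrite var_dotZl var_dotBl.
have := opt _ _ Sstar; rewrite -/r.
have := J_ge_tangent Sv Sstar'.
rewrite var_dotBl.
have := ler_wpM2l (mulr_ge0 (ltW r0) g0) (curvature_le Sv).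
have := curvature_bound_ge0 Sv.
move: (var_dot s _) (var_dot v _) (var_dot v_star _) (Jv d _) (Jv d _) (Jv d _).
move: (curvature d v0) CJ => C B; move=> x y z J1 J2 J3 B0 leC conv dir upper.
have : r * (x - z - r * gamma0 / 2 * B) <= 0.
  rewrite pmulr_rle0//; lra.
have := ler_wpM2l (ltW r0) conv.
lra.
Qed.

End FrankWolfe.

Theorem theorem7 (R : realType) (nx nw ny T N : nat)
  (d : design_data R nx nw ny T N)
  (nx_gt0 : (0 < nx)%N) (leT : (nx <= T)%N) (N_gt0 : (0 < N)%N)
  (uco : uniformly_completely_observable d)
  (Sigma_pd : posdef (Sigma d))
  (eps_gt0 : 0 < eps d) (kappa_gt0 : 0 < kappa d)
  (strict_feas : theta0 d < theta d)
  (v : nat -> var R nx nw T N)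
  (Phi0 : 'M[R]_(stacked T nx, stacked T nx + stacked T ny))
  (feas0 : design_feasible d Phi0 (v 0%N))
  (inS0 : Sset d (v 0%N) Phi0 (v 0%N))
  (gamma0 : R) (gamma0_ge0 : 0 <= gamma0)
  (Phis : nat -> 'M[R]_(stacked T nx, stacked T nx + stacked T ny))
  (s : nat -> var R nx nw T N)
  (dirs : forall k, fw_direction d (v 0%N) gamma0 k (v k) (Phis k) (s k))
  (steps : forall k, v k.+1 = fw_next k (v k) (s k))
  (Phi_star : 'M[R]_(stacked T nx, stacked T nx + stacked T ny))
  (v_star : var R nx nw T N)
  (opt_star : design_optimal d Phi_star v_star)
  (inS_star : Sset d (v 0%N) Phi_star v_star)
  (k : nat) (k_gt0 : (0 < k)%N) :
  Jv d (v k) - Jv d v_star <=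
    2 * curvature_bound d (v 0%N) * (1 + gamma0) / (k%:R + 2).
Proof.
have Sstar : Sset_proj d (v 0%N) v_star by exists Phi_star.
have S0 : Sset_proj d (v 0%N) (v 0%N) by exists Phi0.
have step m Sv := fw_step_gap nx_gt0 Sigma_pd eps_gt0 kappa_gt0 gamma0_ge0
  (Sv : Sset_proj d (v 0%N) (v m)) Sstar (dirs m).
have Sv m : Sset_proj d (v 0%N) (v m).
  by elim: m => // m Sm; rewrite steps; have [] := step m Sm.
have C0 := curvature_bound_ge0 nx_gt0 Sigma_pd eps_gt0 kappa_gt0 S0.
set C := curvature_bound d (v 0%N) in C0 *.
have g1 : 0 <= C * (1 + gamma0) by rewrite mulr_ge0// addr_ge0.
have -> : 2 * C * (1 + gamma0) = 2 * (C * (1 + gamma0)) by rewrite mulrA.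
have {}step m : Jv d (v m.+1) - Jv d v_star <=
    (1 - step_size m) * (Jv d (v m) - Jv d v_star)
    + step_size m ^+ 2 / 2 * (C * (1 + gamma0)).
  by rewrite steps; have [] := step m (Sv m).
move: (C * (1 + gamma0)) g1 step => B B0 step.
(* The first step has length 1 and forgets the initial gap, which is why the
   induction starts at iteration 1. *)
case: k k_gt0 => // k _; elim: k => [|k IH].
  have := step 0%N; rewrite /step_size add0r divff// subrr mul0r add0r.
  move=> /le_trans; apply; rewrite expr1n.
  have -> : 2 * B / (1%:R + 2) = 2 / 3 * B by field.
  lra.
apply: (le_trans (step k.+1)); rewrite /step_size.
move: IH; set x : R := k.+1%:R => IH.
have x0 : 0 <= x by rewrite ler0n.
have -> : k.+2%:R = x + 1 :> R by rewrite -[in LHS]addn1 natrD.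
have r1 : 0 <= 1 - 2 / (x + 2).
  by rewrite subr_ge0 ler_pdivrMr ?mul1r ?lerDr// ltr_wpDl.
rewrite (le_trans (lerD (ler_wpM2l r1 IH) (lexx _)))// -subr_ge0.
have -> : 2 * B / (x + 1 + 2) - ((1 - 2 / (x + 2)) * (2 * B / (x + 2))
    + (2 / (x + 2)) ^+ 2 / 2 * B) = 2 * B / ((x + 2) ^+ 2 * (x + 3)).
  by field; apply/andP; split; apply: lt0r_neq0; lra.
by rewrite divr_ge0 ?mulr_ge0 ?exprn_ge0//; lra.
Qed.
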